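(* Let $k\ge1$ be an integer, let $G$ be a finite graph, and let $S$ be a (symmetric) set of proper separations of $G$ of order $<k$ that includes all the tight proper separations of $G$ of order $<k$. Then $G$ has an $S$-canonical tree-decomposition all whose separations induced by tree-edges are in $S$ such that (i) distinct $k$-blocks lie in different parts; (ii) parts containing a $k$-block that is well separated in $S$ coincide with that $k$-block; (iii) if the task $(S,\mathcal P)$, with $\mathcal P$ the set of all $k$-block profiles, is reduced and feasible, then every leaf part is a $k$-block. Moreover, every $S$-canonical tree-decomposition of $G$ all whose separations induced by tree-edges are in $S$ and which satisfies (i), but not necessarily (ii) or (iii), can be refined to an $S$-canonical tree-decomposition of $G$ all whose separations induced by tree-edges are in $S$ that satisfies (i) and also (ii) and (iii).
   Context: A separation of $G=(V,E)$ is an ordered pair $(A,B)$ with $A\cup B=V$ such that no edge joins $A\setminus B$ to $B\setminus A$; its order is $|A\cap B|$. It is proper if neither $A\subseteq B$ nor $B\subseteq A$, and tight if every vertex in $A\cap B$ has a neighbour in $A\setminus B$ and a neighbour in $B\setminus A$. Write $(A,B)\le(C,D)$ if $A\subseteq C$ and $B\supseteq D$. Two separations are nested if one is $\le$-comparable with the other or with the other's inverse (the inverse of $(C,D)$ is $(D,C)$); otherwise they cross. A set of separations is symmetric (a separation system) if it is closed under taking inverses. A $k$-block of $G$ is a maximal set $X$ of at least $k$ vertices such that no two vertices $x,x'\in X$ can be separated in $G$ by fewer than $k$ vertices other than $x$ and $x'$. The $k$-profile induced by a $k$-block $X$ (a $k$-block profile) is the set $P_k(X)$ of all separations $(A,B)$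 of $G$ of order $<k$ with $X\subseteq B$. The $k$-block $X$ is well separated in $S$ if the $\le$-maximal elements of $P_k(X)\cap S$ are pairwise nested. Let $\mathcal P$ be the set of all $k$-block profiles of $G$. The task $(S,\mathcal P)$ is reduced if for every $(A,B)\in S$ there are $P,P'\in\mathcal P$ with $(A,B)\in P$ and $(B,A)\in P'$. It is feasible if, whenever $(A,B),(C,D)\in S$ cross and there are $P,P'\in\mathcal P$ with $(A,B),(C,D)\in P$ and $(B,A),(D,C)\in P'$, there exists $(E,F)\in P\cap S$ with $(A\cup C,B\cap D)\le(E,F)$. For a tree-decomposition $(T,(V_t)_{t\in T})$ of $G$, each edge $e=t_1t_2$ of $T$ induces the separation $\big(\bigcup_{t\in T_1}V_t,\bigcup_{t\in T_2}V_t\big)$ and its inverse, where $T_i$ is the component of $T-e$ containing $t_i$. The sets $V_t$ are the parts; a leaf part is a part $V_t$ with $t$ a leaf of $T$. The tree-decomposition is $S$-canonical if it is invariant under all automorphisms of $G$ that act on $S$, i.e. for every automorphism $\alpha$ of $G$ mapping $S$ to itself there is an automorphism $\varphi$ of $T$ with $\alpha(V_t)=V_{\varphi(t)}$ for all $t\in T$. A tree-decomposition refines another if the set of separations induced by the edges of its tree contains the set of separations induced by the edges of the tree of the other. *)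

(* Defs.v *)
From mathcomp Require Import all_boot.
From mathcomp Require Import perm.

Set Implicit Arguments.
Unset Strict Implicit.
Unset Printing Implicit Defensive.

Record sgraph := SGraph {
  vertex :> finType;
  adj : rel vertex;
  adj_sym : symmetric adj;
  adj_irrefl : irreflexive adj
}.

Arguments adj {_}.

Notation setpair G := ({set vertex G} * {set vertex G})%type.

Section Separations.
Variable G : sgraph.
Implicit Types (r s : setpair G) (S P : {set setpair G}) (X Z : {set G}).

Definition separation s : bool :=
  (s.1 :|: s.2 == [set: G]) &&
  [forall x in s.1 :\: s.2, forall y in s.2 :\: s.1, ~~ adj x y].

Definition sep_order s : nat := #|s.1 :&: s.2|.

Definition sep_inv s : setpair G := (s.2, s.1).

Definition proper_sep s : bool :=
  [&& separation s, ~~ (s.1 \subset s.2) & ~~ (s.2 \subset s.1)].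

Definition tight_sep s : bool :=
  separation s &&
  [forall x in s.1 :&: s.2,
     [exists y in s.1 :\: s.2, adj x y] && [exists y in s.2 :\: s.1, adj x y]].

Definition sep_le r s : bool := (r.1 \subset s.1) && (s.2 \subset r.2).

Definition nested r s : bool :=
  [|| sep_le r s, sep_le s r, sep_le r (sep_inv s) | sep_le (sep_inv s) r].

Definition cross r s : bool := ~~ nested r s.

Definition symmetric_system S : Prop := forall s, s \in S -> sep_inv s \in S.

Definition separates Z (x y : G) : bool :=
  [&& x \notin Z, y \notin Z &
      ~~ connect [rel u v | [&& adj u v, u \notin Z & v \notin Z]] x y].

Definition inseparable k X : bool :=
  [forall x in X, forall y in X, forall Z : {set G},
     (#|Z| < k) ==> ~~ separates Z x y].

Definition kblock k X : bool :=
  maxset (fun Y : {set G} => (k <= #|Y|) && inseparable k Y) X.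

Definition block_profile k X : {set setpair G} :=
  [set s | [&& separation s, sep_order s < k & X \subset s.2]].

Definition block_profiles k : {set {set setpair G}} :=
  [set block_profile k X | X : {set G} & kblock k X].

Definition sep_maximal P s : Prop :=
  s \in P /\ forall r, r \in P -> sep_le s r -> r = s.

Definition well_separated k S X : Prop :=
  forall r s, sep_maximal (block_profile k X :&: S) r ->
              sep_maximal (block_profile k X :&: S) s -> nested r s.

Definition reduced S (Ps : {set {set setpair G}}) : Prop :=
  forall s, s \in S ->
    exists P P', [/\ P \in Ps, P' \in Ps, s \in P & sep_inv s \in P'].

Definition feasible S (Ps : {set {set setpair G}}) : Prop :=
  forall r s, r \in S -> s \in S -> cross r s ->
  forall P P', P \in Ps -> P' \in Ps ->
    r \in P -> s \in P -> sep_inv r \in P' -> sep_inv s \in P' ->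
  exists2 q, q \in P :&: S & sep_le (r.1 :|: s.1, r.2 :&: s.2) q.

Definition automorphism (a : {perm G}) : Prop :=
  forall x y, adj (a x) (a y) = adj x y.

Definition acts_on_system (a : {perm G}) S : Prop :=
  [set (a @: (s : setpair G).1, a @: s.2) | s in S] = S.

(* Degree exactly one: the single node of a one-vertex tree is not a leaf. *)
Definition leaf (t : G) : bool := #|[set u | adj t u]| == 1.

Definition is_tree : Prop :=
  [/\ 0 < #|G|,
      forall t u : G, connect adj t u
    & forall c : seq G, 2 < size c -> ~~ ucycleb adj c].

End Separations.

Record tree_decomposition (G : sgraph) := TreeDecomposition {
  td_tree : sgraph;
  td_part : td_tree -> {set G};
  td_is_tree : is_tree td_tree;
  td_cover_vertex : forall x, exists t, x \in td_part t;
  td_cover_edge : forall x y : G, adj x y ->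
    exists t, (x \in td_part t) && (y \in td_part t);
  td_path : forall (t : td_tree) (p : seq td_tree) (u : td_tree),
    path adj t p -> uniq (t :: p) -> u \in t :: p ->
    td_part t :&: td_part (last t p) \subset td_part u
}.

Section TreeDecompositions.
Variables (G : sgraph) (S : {set setpair G}).
Implicit Type D : tree_decomposition G.

(* The union of the parts V_t with t in the component of T - tu containing t. *)
Definition td_side D (t u : td_tree D) : {set G} :=
  \bigcup_(v | connect [rel a b | adj a b && ([set a; b] != [set t; u])] t v)
    td_part v.

(* As (t, u) ranges over ordered pairs, both orientations are included. *)
Definition induced_seps D : {set setpair G} :=
  [set (td_side e.1 e.2, td_side e.2 e.1)
     | e : td_tree D * td_tree D & adj e.1 e.2].

Definition canonical_td D : Prop :=
  forall a : {perm G}, automorphism a -> acts_on_system a S ->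
  exists2 f : {perm td_tree D}, automorphism f &
    forall t, a @: td_part t = td_part (f t).

Definition refines D' D : Prop := induced_seps D \subset induced_seps D'.

Definition separates_blocks k D : Prop :=
  (forall X : {set G}, kblock k X -> exists t : td_tree D, X \subset td_part t) /\
  (forall (X Y : {set G}) (t u : td_tree D), kblock k X -> kblock k Y -> X <> Y ->
     X \subset td_part t -> Y \subset td_part u -> td_part t <> td_part u).

Definition isolates_well_separated_blocks k D : Prop :=
  forall (X : {set G}) (t : td_tree D), kblock k X -> well_separated k S X ->
    X \subset td_part t -> td_part t = X.

Definition leaf_parts_are_blocks k D : Prop :=
  forall t : td_tree D, leaf t -> kblock k (td_part t).

End TreeDecompositions.

(* Main.v *)
Require Import Defs.
From mathcomp Require Import all_boot perm fingroup.

(** Call a separation efficient for a pair of blocks if it distinguishes them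
    with minimal order; such separations are tight, hence in [S].  For every pair
    of blocks take the efficient separations crossing the fewest separations.  If
    two of these crossed, submodularity would make two opposite corners efficient
    for the same pairs, and together the corners cross fewer separations: so the
    chosen set is nested, and it is canonical.

    If [X] is well separated, every element of [S] is, up to inversion, below a
    maximal element of the profile of [X], hence nested with all of these maximal
    elements.  They can thus be added to any nested subset of [S], and a part
    containing [X] then shrinks to [X].  A block in a leaf part of a reduced and
    feasible task is well separated, so (iii) follows from (i) and (ii).

    A nested set of proper separations is turned into a tree-decomposition whose
    nodes are its consistent orientations; conversely the separations induced by
    a given tree-decomposition are nested. *)

Set Implicit Arguments.
Unset Strict Implicit.
Unset Printing Implicit Defensive.

(** * Order and crossing *)

Section SeparationOrder.
Variable G : sgraph.
Implicit Types (r s t : setpair G) (P : {set setpair G}).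

Lemma sep_invK s : sep_inv (sep_inv s) = s.
Proof. by case: s. Qed.

Lemma sep_le_refl s : sep_le s s.
Proof. by rewrite /sep_le !subxx. Qed.

Lemma sep_le_trans s r t : sep_le r s -> sep_le s t -> sep_le r t.
Proof.
case/andP=> h1 h2 /andP[h3 h4].
by rewrite /sep_le (subset_trans h1 h3) (subset_trans h4 h2).
Qed.

Lemma sep_le_anti r s : sep_le r s -> sep_le s r -> r = s.
Proof.
case: r s => [a b] [c d] /andP[/= h1 h2] /andP[/= h3 h4].
by congr (_, _); apply/eqP; rewrite eqEsubset ?h1 ?h2 ?h3 ?h4.
Qed.

Lemma sep_le_inv r s : sep_le (sep_inv r) (sep_inv s) = sep_le s r.
Proof. by rewrite /sep_le andbC. Qed.

Lemma sep_le_invr r s : sep_le r (sep_inv s) = sep_le s (sep_inv r).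
Proof. by rewrite -sep_le_inv sep_invK. Qed.

Lemma sep_le_invl r s : sep_le (sep_inv r) s = sep_le (sep_inv s) r.
Proof. by rewrite -sep_le_inv sep_invK. Qed.

Lemma nestedC r s : nested r s = nested s r.
Proof.
rewrite /nested (sep_le_invr r s) (sep_le_invl s r).
by case: (sep_le r s); case: (sep_le s r).
Qed.

Lemma nested_invr r s : nested r (sep_inv s) = nested r s.
Proof.
rewrite /nested !sep_invK.
by case: (sep_le r s); case: (sep_le s r); rewrite ?orbT //=;
   case: (sep_le r _); case: (sep_le _ r).
Qed.

Lemma nested_invl r s : nested (sep_inv r) s = nested r s.
Proof. by rewrite nestedC nested_invr nestedC. Qed.

Lemma nested_refl s : nested s s.
Proof. by rewrite /nested sep_le_refl. Qed.

Lemma sep_le_nested r s : sep_le r s -> nested r s.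
Proof. by rewrite /nested => ->. Qed.

(* Up to inverting [t], a separation nested with [r] lies below [r] or below
   its inverse. *)
Lemma nested_below t r : nested t r ->
  exists2 u, u = t \/ u = sep_inv t & sep_le u r \/ sep_le u (sep_inv r).
Proof.
case/or4P=> h.
- by exists t; auto.
- by exists (sep_inv t); auto; right; rewrite sep_le_inv.
- by exists t; auto.
- by exists (sep_inv t); auto; left; rewrite sep_le_invl.
Qed.

(** * Corners and the number of pairs they cross *)

(** The infimum of [r] and [s] for [sep_le]; the supremum is
    [sep_inv (corner (sep_inv r) (sep_inv s))]. *)
Definition corner r s : setpair G := (r.1 :&: s.1, r.2 :|: s.2).

Lemma cornerC r s : corner r s = corner s r.
Proof. by rewrite /corner setIC setUC. Qed.

Lemma corner_lel r s : sep_le (corner r s) r.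
Proof. by rewrite /sep_le subsetIl subsetUl. Qed.

Lemma corner_ler r s : sep_le (corner r s) s.
Proof. by rewrite cornerC corner_lel. Qed.

Lemma le_corner t r s : sep_le t r -> sep_le t s -> sep_le t (corner r s).
Proof.
case/andP=> h1 h2 /andP[h3 h4].
by rewrite /sep_le subsetI h1 h3 subUset h2 h4.
Qed.

(** Orient [t] below [r] or [sep_inv r], and below [s] or [sep_inv s]. If it is below one of the
    inverses, it is below the inverse of the corner. Otherwise either one orientation is below both
    [r] and [s], hence below their infimum, or opposite orientations are; then [sep_inv s] is below
    [r], so [r] and [s] would not cross. *)
Lemma nested_corner t r s :
  cross r s -> nested t r -> nested t s -> nested t (corner r s).
Proof.
move=> rs /nested_below[u tu ur] /nested_below[v tv vs].
have nu w : w = t \/ w = sep_inv t -> nested w (corner r s) ->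
    nested t (corner r s).
  by case=> ->; rewrite ?nested_invl.
have low w x : sep_le (corner r s) x -> sep_le w (sep_inv x) ->
    nested w (corner r s).
  move=> cx wx; rewrite -nested_invr; apply: sep_le_nested.
  by apply: sep_le_trans wx _; rewrite sep_le_inv.
case: ur => [ur|ur]; last exact: nu tu (low _ _ (corner_lel r s) ur).
case: vs => [vs|vs]; last exact: nu tv (low _ _ (corner_ler r s) vs).
have [uv|uv] : u = v \/ u = sep_inv v.
  by case: tu => ->; case: tv => ->; rewrite ?sep_invK; auto.
  by apply: nu tu _; apply: sep_le_nested; apply: le_corner => //; rewrite uv.
case/negP: rs; rewrite -nested_invr nestedC; apply: sep_le_nested.
by apply: sep_le_trans ur; rewrite uv sep_le_inv.
Qed.

(** Oriented below [r], [t] is below the supremum of [r] and [s]; oriented below [sep_inv r], it is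
    below the inverse of their infimum. *)
Lemma nested_corner_or t r s : nested t r ->
  nested t (corner r s) || nested t (corner (sep_inv r) (sep_inv s)).
Proof.
move=> /nested_below[u tu ur].
have nu c : nested u c = nested t c by case: tu => ->; rewrite ?nested_invl.
rewrite -!nu; case: ur => ur; apply/orP; [right|left];
  rewrite -nested_invr; apply: sep_le_nested; apply: sep_le_trans ur _.
  by rewrite sep_le_invr corner_lel.
by rewrite sep_le_inv corner_lel.
Qed.

(** The count runs over all pairs of vertex sets, so it does not depend on [S] and is preserved by
    automorphisms. *)
Definition crossing_number r := #|[set t | cross t r]|.

Lemma crossing_number_inv r : crossing_number (sep_inv r) = crossing_number r.
Proof. by apply: eq_card => t; rewrite !inE /cross nested_invr. Qed.

(** By inclusion-exclusion it is enough to compare unions and intersections. What crosses some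
    corner crosses [r] or [s], and what crosses both corners crosses both. Strictness comes from
    [r], which crosses [s] but is nested with both corners. *)
Lemma crossing_number_corners r s : cross r s ->
  crossing_number (corner r s) + crossing_number (corner (sep_inv r) (sep_inv s))
    < crossing_number r + crossing_number s.
Proof.
move=> rs; rewrite /crossing_number -cardsUI -[X in _ < X]cardsUI.
have rs' : cross (sep_inv r) (sep_inv s) by rewrite /cross nested_invl nested_invr.
have nc t : nested t r -> nested t s ->
  nested t (corner r s) && nested t (corner (sep_inv r) (sep_inv s)).
  by move=> h1 h2; rewrite !nested_corner // nested_invr.
rewrite -addSn leq_add //; last first.
  apply: subset_leq_card; apply/subsetP => t; rewrite !inE -!negb_or.
  apply: contra => /orP[]; first exact: nested_corner_or.
  by rewrite cornerC (cornerC (sep_inv r)); apply: nested_corner_or.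
apply: proper_card; apply/properP; split.
  apply/subsetP => t; rewrite !inE -!negb_and.
  by apply: contra => /andP[]; apply: nc.
exists r; first by rewrite !inE rs orbT.
rewrite !inE -negb_and negbK nestedC sep_le_nested ?corner_lel //=.
by rewrite nestedC -nested_invr sep_le_nested ?corner_lel.
Qed.

(** The weight [#|A| + #|~: B|] increases strictly along the order on pairs [(A, B)], so maximal
    elements can be found by maximising it. *)
Lemma sep_le_card r s : sep_le r s ->
  #|s.1| + #|~: s.2| <= #|r.1| + #|~: r.2| -> r = s.
Proof.
case/andP=> h1 h2 hc; have h2' : ~: r.2 \subset ~: s.2 by rewrite setCS.
have c1 := subset_leq_card h1; have c2 := subset_leq_card h2'.
have e1 : r.1 = s.1.
  by apply/eqP; rewrite eqEcard h1 -(leq_add2r #|~: r.2|) (leq_trans _ hc) ?leq_add2l.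
have e2 : r.2 = s.2.
  apply: setC_inj; apply/eqP; rewrite eqEcard h2' -(leq_add2l #|r.1|).
  by rewrite (leq_trans _ hc) ?leq_add2r.
by case: r s e1 e2 {h1 h2 h2' hc c1 c2} => [? ?] [? ?] /= -> ->.
Qed.

Lemma exists_sep_maximal P s : s \in P ->
  exists2 m, sep_maximal P m & sep_le s m.
Proof.
move=> sP.
have i0 : (s \in P) && sep_le s s by rewrite sP sep_le_refl.
have [m /andP[mP sm] mmax] :=
  @arg_maxnP _ s (fun t => (t \in P) && sep_le s t) (fun t => #|t.1| + #|~: t.2|) i0.
exists m => //; split=> // r rP mr; apply/esym; apply: sep_le_card => //.
by apply: mmax; rewrite rP (sep_le_trans sm mr).
Qed.

End SeparationOrder.

(** * Efficient separations of blocks *)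

Section Blocks.
Variables (G : sgraph) (k : nat).
Implicit Types (r s t : setpair G) (U X Y Z W : {set G}).

(** * Separations, separators and submodularity *)

Lemma sep_inv_separation s : separation (sep_inv s) = separation s.
Proof.
rewrite /separation /= setUC; congr (_ && _).
apply/'forall_in_forall_inP/'forall_in_forall_inP => h x xs y ys;
  by rewrite adj_sym; apply: h.
Qed.

Lemma sep_order_inv s : sep_order (sep_inv s) = sep_order s.
Proof. by rewrite /sep_order setIC. Qed.

Lemma separationP s :
  reflect (s.1 :|: s.2 = setT /\
           (forall x y, x \notin s.2 -> y \notin s.1 -> ~~ adj x y))
          (separation s).
Proof.
apply: (iffP andP) => [[/eqP e /'forall_in_forall_inP h]|[e h]].
  split=> // x y xs ys.
  have u z : (z \in s.1) || (z \in s.2) by rewrite -in_setU e inE.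
  apply: h; rewrite inE ?xs ?ys /=; first by move: (u x); rewrite (negPf xs) orbF.
  by move: (u y); rewrite (negPf ys).
split; first exact/eqP.
by apply/'forall_in_forall_inP => x; rewrite inE => /andP[xs _] y;
  rewrite inE => /andP[ys _]; apply: h.
Qed.

Lemma separation_cover s x : separation s -> (x \in s.1) || (x \in s.2).
Proof. by case/separationP => e _; rewrite -in_setU e inE. Qed.

Lemma separation_corner r s :
  separation r -> separation s -> separation (corner r s).
Proof.
move=> hr hs; have [_ ar] := separationP _ hr; have [_ as'] := separationP _ hs.
apply/separationP; split=> /=.
  apply/setP => x; rewrite !inE.
  move: (separation_cover x hr) (separation_cover x hs).
  by case: (x \in r.1); case: (x \in r.2); case: (x \in s.1); case: (x \in s.2).
move=> x y; rewrite !inE negb_or negb_and => /andP[xr xs] /orP[yr|ys].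
  exact: ar.
exact: as'.
Qed.

(** Submodularity, by inclusion-exclusion: the union and the intersection of the corner separators
    lie in the union and the intersection of the separators of [r] and [s]. *)
Lemma sep_order_corners r s :
  sep_order (corner r s) + sep_order (corner (sep_inv r) (sep_inv s))
    <= sep_order r + sep_order s.
Proof.
rewrite /sep_order -cardsUI -[X in _ <= X]cardsUI.
apply: leq_add; apply: subset_leq_card; apply/subsetP => x; rewrite !inE /=;
by case: (x \in r.1); case: (x \in r.2); case: (x \in s.1); case: (x \in s.2).
Qed.

Lemma separates_separation Z x y : separates Z x y ->
  exists s, [/\ separation s, s.1 :&: s.2 = Z, x \notin s.2 & y \notin s.1].
Proof.
case/and3P=> xZ yZ; set e := (X in connect X) => nxy.
(* The component of [x] in [G - Z]; every edge leaving it ends in [Z]. *)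
pose C := [set v | connect e x v].
have CZ v : v \in C -> v \notin Z.
  rewrite inE => /connectP[p].
  elim/last_ind: p => [_ -> //|p w _]; rewrite rcons_path last_rcons.
  by case/andP=> _ /and3P[_ _ wZ] ->.
have xC : x \in C by rewrite inE connect0.
exists (C :|: Z, ~: C); split=> /=.
- apply/separationP; split=> /= [|u v].
    by apply/setP => v; rewrite !in_setU in_setC in_setT; case: (v \in C); rewrite ?orbT.
  rewrite in_setC negbK in_setU negb_or => uC /andP[vC vZ]; apply: contra vC => uv.
  move: (uC); rewrite !inE => xu; apply: connect_trans xu (connect1 _).
  by rewrite /e /= uv vZ (CZ u uC).
- apply/setP => v; rewrite in_setI in_setU in_setC.
  case vC: (v \in C) => /=; last by rewrite andbT.
  by apply/esym/negbTE/CZ.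
- by rewrite in_setC xC.
- by rewrite !inE (negPf nxy).
Qed.

Lemma separation_separates s x y : separation s ->
  x \notin s.2 -> y \notin s.1 -> separates (s.1 :&: s.2) x y.
Proof.
move=> hs x2 y1; rewrite /separates !inE (negPf x2) (negPf y1) andbF /=.
apply/negP => /connectP[p].
elim: p x x2 => [|z p IH] x x2 /=; first by move=> _ yx; move: y1;
  rewrite yx; move: (separation_cover x hs); rewrite (negPf x2) orbF => ->.
case/andP=> /and3P[xz _ zs]; apply: IH.
move: zs; rewrite inE negb_and => /orP[z1|//].
by have [_ /(_ x z x2 z1)] := separationP _ hs; rewrite xz.
Qed.

(** * The side on which a block lies *)

Lemma kblock_card X : kblock k X -> k <= #|X|.
Proof. by case/maxsetP=> /andP[]. Qed.

Lemma kblock_side X s : kblock k X -> separation s -> sep_order s < k ->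
  (X \subset s.1) || (X \subset s.2).
Proof.
case/maxsetP=> /andP[_ /'forall_in_forall_inP h] _ hs os.
apply/negPn; rewrite negb_or; apply/negP => /andP[/subsetPn[y yX y1] /subsetPn[x xX x2]].
have /forallP /(_ (s.1 :&: s.2)) := h x xX y yX.
by rewrite -/(sep_order s) os separation_separates.
Qed.

(** A block contained in both sides would lie in the separator, which has fewer than [k]
    vertices. *)
Lemma kblock_sideN X s : kblock k X -> separation s -> sep_order s < k ->
  (X \subset s.1) = ~~ (X \subset s.2).
Proof.
move=> bX hs os; have := kblock_side bX hs os.
case X2: (X \subset s.2); last by rewrite orbF.
rewrite orbT => _; apply/negP => X1.
have : #|X| <= sep_order s by apply: subset_leq_card; rewrite subsetI X1 X2.
by rewrite leqNgt (leq_trans os) ?kblock_card.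
Qed.

(** By maximality of [X] the larger set [U] is not inseparable; fewer than [k] vertices separating
    two of its elements yield the separation. *)
Lemma kblock_proper_split X U : kblock k X -> X \proper U ->
  exists s, [/\ separation s, sep_order s < k,
                ~~ (U \subset s.1) & ~~ (U \subset s.2)].
Proof.
move=> /maxsetP[/andP[cX _] mX] XU.
have : ~~ inseparable k U.
  apply/negP => iU; have := mX U.
  rewrite iU (leq_trans cX (subset_leq_card (proper_sub XU))) => /(_ isT (proper_sub XU)) e.
  by move: XU; rewrite e properxx.
case/forall_inPn => x xU /forall_inPn[y yU] /forallPn[Z].
rewrite negb_imply negbK => /andP[cZ sZ].
have [s [hs eZ x2 y1]] := separates_separation sZ.
exists s; split; rewrite ?/sep_order ?eZ //.
  by apply/subsetPn; exists y.
by apply/subsetPn; exists x.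
Qed.

(** * Separations distinguishing two sets with minimal order *)

(** Negated inclusions make this usable for a single vertex against a block. Between blocks, and
    below order [k], it says that [U] lies in [s.1] and [X] in [s.2]. *)
Definition distinguishes s U X := ~~ (U \subset s.2) && ~~ (X \subset s.1).

Definition efficient s U X :=
  [&& separation s, distinguishes s U X &
      [forall r, separation r && distinguishes r U X ==> (sep_order s <= sep_order r)]].

Lemma efficientP s U X :
  reflect [/\ separation s, distinguishes s U X &
              forall r, separation r -> distinguishes r U X -> sep_order s <= sep_order r]
          (efficient s U X).
Proof.
apply: (iffP and3P) => [[hs ds /forall_inP h]|[hs ds h]]; split=> //.
  by move=> r hr dr; apply: h; rewrite hr.
by apply/forall_inP => r /andP[]; apply: h.
Qed.

Lemma distinguishes_inv s U X : distinguishes (sep_inv s) X U = distinguishes s U X.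
Proof. by rewrite /distinguishes andbC. Qed.

Lemma efficient_inv s U X : efficient (sep_inv s) X U = efficient s U X.
Proof.
suff h r V Y : efficient r V Y -> efficient (sep_inv r) Y V.
  by apply/idP/idP => /h //; rewrite sep_invK.
case/efficientP=> hr dr mr; apply/efficientP; split.
- by rewrite sep_inv_separation.
- by rewrite distinguishes_inv.
move=> t ht dt; rewrite sep_order_inv -(sep_order_inv t).
by apply: mr; rewrite ?sep_inv_separation ?distinguishes_inv.
Qed.

Lemma efficient_exists s U X : separation s -> distinguishes s U X ->
  exists2 r, efficient r U X & sep_order r <= sep_order s.
Proof.
move=> hs ds.
have i0 : separation s && distinguishes s U X by rewrite hs ds.
have [r /andP[hr dr] mr] := @arg_minnP _ s
  (fun r => separation r && distinguishes r U X) (@sep_order G) i0.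
exists r; last exact: mr.
by apply/efficientP; split=> // t ht dt; apply: mr; rewrite ht.
Qed.

Lemma efficient_proper s U X : efficient s U X -> proper_sep s.
Proof.
case/efficientP=> hs /andP[/subsetPn[u uU u2] /subsetPn[x xX x1]] _.
apply/and3P; split=> //; apply/subsetPn; [exists u|exists x] => //.
  by move: (separation_cover u hs); rewrite (negPf u2) orbF.
by move: (separation_cover x hs); rewrite (negPf x1).
Qed.

(* A separator vertex without a neighbour in [s.1 :\: s.2] could be removed from
   [s.1], lowering the order. *)
Lemma efficient_neighbour s U X v : efficient s U X -> v \in s.1 :&: s.2 ->
  [exists y in s.1 :\: s.2, adj v y].
Proof.
case/efficientP=> hs /andP[dU dX] ms vs; apply: contraT => /exists_inPn nv.
move: (vs); rewrite inE => /andP[v1 v2].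
have hr : separation (s.1 :\ v, s.2).
  apply/separationP; split=> /= [|x y x2].
    apply/setP => y; rewrite !inE; have := separation_cover y hs.
    by case: (y =P v) => [->|_]; rewrite ?v2 ?orbT.
  rewrite in_setD1 negb_and negbK => /orP[/eqP->|y1].
    rewrite adj_sym; apply: nv; rewrite inE x2 /=.
    by move: (separation_cover x hs); rewrite (negPf x2) orbF.
  by have [_ /(_ x y x2 y1)] := separationP _ hs.
have := ms _ hr; rewrite /distinguishes /= dU /=.
have -> : ~~ (X \subset s.1 :\ v).
  by rewrite (contra _ dX) // => XS; rewrite (subset_trans XS) ?subsetDl.
rewrite leqNgt => /(_ isT)/negP[].
apply: proper_card; apply/properP; split; first by rewrite setSI // subsetDl.
by exists v => //; rewrite !inE eqxx.
Qed.

Lemma efficient_tight s U X : efficient s U X -> tight_sep s.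
Proof.
move=> es; have [hs _ _] := efficientP _ _ _ es.
apply/andP; split=> //; apply/forall_inP => v vs.
rewrite (efficient_neighbour es vs) /=.
by rewrite -efficient_inv in es; apply: (efficient_neighbour (s := sep_inv s) es); rewrite setIC.
Qed.

(** The union of two distinct blocks properly contains one of them, so some separation of small
    order splits it. Each block keeps to one side, so this separation distinguishes them in one of
    its orientations. *)
Lemma kblocks_efficient X Y : kblock k X -> kblock k Y -> X != Y ->
  exists2 s, efficient s X Y & sep_order s < k.
Proof.
move=> bX bY nXY.
have [s [hs os n1 n2]] : exists s, [/\ separation s, sep_order s < k,
    ~~ (X :|: Y \subset s.1) & ~~ (X :|: Y \subset s.2)].
  have [YX|nYX] := boolP (Y \subset X); last first.
    by apply: (kblock_proper_split bX); rewrite properE subsetUl subUset subxx.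
  apply: (kblock_proper_split bY); rewrite properE subsetUr subUset subxx andbT.
  by move: nXY; rewrite eqEsubset YX andbT.
have {n1 n2} : distinguishes s X Y \/ distinguishes (sep_inv s) X Y.
  move: n1 n2; rewrite /distinguishes /= !subUset !negb_and.
  rewrite !(kblock_sideN _ hs os) //.
  by case: (X \subset s.2); case: (Y \subset s.2) => //=; auto.
by case=> /efficient_exists[]; rewrite ?sep_inv_separation ?sep_order_inv // => r er or;
  exists r => //; apply: leq_ltn_trans os.
Qed.

(** The splitting argument applied to [v |: X]. It serves to cut off the vertices outside a well
    separated block. *)
Lemma kblock_efficient_vertex X v : kblock k X -> v \notin X ->
  exists2 s, efficient s [set v] X & sep_order s < k.
Proof.
move=> bX vX.
have [|s [hs os]] := @kblock_proper_split X (v |: X) bX.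
  by rewrite properE subsetUr subUset sub1set (negPf vX).
rewrite !subUset !negb_and (kblock_sideN bX hs os) negbK => n1 n2.
have {n1 n2} : distinguishes s [set v] X \/ distinguishes (sep_inv s) [set v] X.
  rewrite /distinguishes /= (kblock_sideN bX hs os) negbK.
  by case: (X \subset s.2) n1 n2; rewrite /= ?orbT ?orbF ?andbT; auto.
by case=> /efficient_exists[]; rewrite ?sep_inv_separation ?sep_order_inv // => r er or;
  exists r => //; apply: leq_ltn_trans os.
Qed.

Lemma distinguishes_kblocks s X Y : kblock k X -> kblock k Y ->
  separation s -> sep_order s < k ->
  distinguishes s X Y = (X \subset s.1) && (Y \subset s.2).
Proof.
by move=> bX bY hs os; rewrite /distinguishes !(kblock_sideN _ hs os) // negbK.
Qed.

(* Each corner is no smaller than the separation it replaces, so by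
   submodularity both are equally large. *)
Lemma efficient_corners r s X Y Z W :
  kblock k X -> kblock k Y -> kblock k Z -> kblock k W ->
  sep_order r < k -> sep_order s < k ->
  efficient r X Y -> efficient s Z W -> X \subset s.1 -> W \subset r.2 ->
  efficient (corner r s) X Y /\
  efficient (sep_inv (corner (sep_inv r) (sep_inv s))) Z W.
Proof.
move=> bX bY bZ bW or os /efficientP[hr dr mr] /efficientP[hs ds ms] Xs Wr.
have hp := separation_corner hr hs.
have hq : separation (sep_inv (corner (sep_inv r) (sep_inv s))).
  by rewrite sep_inv_separation separation_corner // sep_inv_separation.
have := sep_order_corners r s.
rewrite -(sep_order_inv (corner (sep_inv r) _)).
move: hp hq; set p := corner r s; set q := sep_inv _ => hp hq oo.
move: (dr) (ds); rewrite !distinguishes_kblocks // => /andP[Xr Yr] /andP[Zs Ws].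
have dp : sep_order p < k -> distinguishes p X Y.
  by move=> op; rewrite distinguishes_kblocks //= subsetI Xr Xs subsetU ?Yr.
have dq : sep_order q < k -> distinguishes q Z W.
  by move=> oq; rewrite distinguishes_kblocks //= subsetI Wr Ws subsetU ?Zs ?orbT.
have sq : sep_order s <= sep_order q.
  rewrite leqNgt; apply/negP => qs.
  by have := ms _ hq (dq (ltn_trans qs os)); rewrite leqNgt qs.
have rp : sep_order r <= sep_order p.
  rewrite leqNgt; apply/negP => pr.
  by have := mr _ hp (dp (ltn_trans pr or)); rewrite leqNgt pr.
have pr : sep_order p <= sep_order r.
  by rewrite -(leq_add2r (sep_order s)) (leq_trans _ oo) // leq_add2l.
have qs : sep_order q <= sep_order s.
  by rewrite -(leq_add2l (sep_order r)) (leq_trans _ oo) // leq_add2r.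
split; apply/efficientP; split=> //.
- exact/dp/(leq_ltn_trans pr or).
- by move=> t ht dt; apply: leq_trans pr (mr _ ht dt).
- exact/dq/(leq_ltn_trans qs os).
- by move=> t ht dt; apply: leq_trans qs (ms _ ht dt).
Qed.

(** * The canonical nested set that distinguishes all blocks *)

Definition min_crossing r X Y :=
  efficient r X Y && [forall s, efficient s X Y ==>
                        (crossing_number r <= crossing_number s)].

(** All minimisers for all ordered pairs of blocks are kept: no choice is made that could break a
    symmetry of [G]. *)
Definition block_separators : {set setpair G} :=
  [set r | (sep_order r < k) &&
     [exists X, exists Y, [&& kblock k X, kblock k Y & min_crossing r X Y]]].

Lemma min_crossing_inv r X Y : min_crossing (sep_inv r) Y X = min_crossing r X Y.
Proof.
suff h t V U : min_crossing t V U -> min_crossing (sep_inv t) U V.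
  by apply/idP/idP => /h //; rewrite sep_invK.
case/andP=> et /forall_inP mt; rewrite /min_crossing efficient_inv et.
apply/forall_inP => s es; rewrite crossing_number_inv -(crossing_number_inv s).
by apply: mt; rewrite efficient_inv.
Qed.

Lemma block_separatorsP r :
  reflect (exists X Y, [/\ kblock k X, kblock k Y, sep_order r < k & min_crossing r X Y])
          (r \in block_separators).
Proof.
rewrite inE; apply: (iffP andP) => [[or /existsP[X /existsP[Y /and3P[]]]]|].
  by exists X, Y; split.
case=> X [Y [bX bY or mr]]; split=> //.
by apply/existsP; exists X; apply/existsP; exists Y; apply/and3P.
Qed.

Lemma block_separators_inv r : r \in block_separators -> sep_inv r \in block_separators.
Proof.
case/block_separatorsP=> X [Y [bX bY or mr]]; apply/block_separatorsP.
by exists Y, X; split; rewrite ?sep_order_inv ?min_crossing_inv.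
Qed.

(** The last two inclusions put [X] into the corner [r.1 :&: s.1] and [W] into the opposite one
    [r.2 :&: s.2]. The corners are then efficient replacements for [r] and [s], and crossing fewer
    pairs in total they contradict minimality. *)
Lemma min_crossing_nested r s X Y Z W :
  kblock k X -> kblock k Y -> kblock k Z -> kblock k W ->
  sep_order r < k -> sep_order s < k ->
  min_crossing r X Y -> min_crossing s Z W -> X \subset s.1 -> W \subset r.2 ->
  nested r s.
Proof.
move=> bX bY bZ bW or os /andP[er /forall_inP mr] /andP[es /forall_inP ms] Xs Wr.
apply/negPn/negP => rs.
have [ep eq] := efficient_corners bX bY bZ bW or os er es Xs Wr.
have := crossing_number_corners rs; rewrite ltnNge => /negP; apply.
by rewrite leq_add ?mr // -[leqRHS]crossing_number_inv ms.
Qed.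

Lemma efficient_order r s X Y :
  efficient r X Y -> efficient s X Y -> sep_order r = sep_order s.
Proof.
case/efficientP=> hr dr mr /efficientP[hs ds ms].
by apply/eqP; rewrite eqn_leq mr ?ms.
Qed.

(* If each of two separations distinguishes the other one's blocks, both are
   efficient, and have minimal crossing number, for the same pair. *)
Lemma min_crossing_both r s X Y Z W :
  kblock k X -> kblock k Y -> kblock k Z -> kblock k W ->
  sep_order r < k -> sep_order s < k ->
  min_crossing r X Y -> min_crossing s Z W ->
  distinguishes s X Y -> distinguishes (sep_inv r) Z W -> min_crossing s X Y.
Proof.
move=> bX bY bZ bW or os /andP[er /forall_inP mr] /andP[es /forall_inP ms] ds dr.
have [hr _ rmin] := efficientP _ _ _ er; have [hs _ smin] := efficientP _ _ _ es.
have rs := rmin _ hs ds.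
have sr : sep_order s <= sep_order r.
  by rewrite -(sep_order_inv r) smin ?sep_inv_separation.
have es' : efficient s X Y.
  by apply/efficientP; split=> // t ht dt; apply: leq_trans sr (rmin _ ht dt).
have er' : efficient (sep_inv r) Z W.
  apply/efficientP; split; rewrite ?sep_inv_separation //.
  by move=> t ht dt; rewrite sep_order_inv; apply: leq_trans rs (smin _ ht dt).
rewrite /min_crossing es'; apply/forall_inP => t et.
by rewrite (leq_trans _ (mr _ et)) // -(crossing_number_inv r) ms.
Qed.

(** The previous argument is tried for all orientations of [r] and [s]. It fails only when each
    separation distinguishes the blocks of the other; then both are minimisers for [X] and [Y], and
    it applies to that single pair. *)
Lemma block_separators_nested r s :
  r \in block_separators -> s \in block_separators -> nested r s.
Proof.
case/block_separatorsP=> X [Y [bX bY or mr]] /block_separatorsP[Z [W [bZ bW os ms]]].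
have hr : separation r by case/andP: mr => /efficientP[].
have hs : separation s by case/andP: ms => /efficientP[].
have mr' := mr; have ms' := ms.
rewrite -min_crossing_inv in mr'; rewrite -min_crossing_inv in ms'.
have ori : sep_order (sep_inv r) < k by rewrite sep_order_inv.
have osi : sep_order (sep_inv s) < k by rewrite sep_order_inv.
have side1 := kblock_sideN _ hr or; have side2 := kblock_sideN _ hs os.
have c1 := min_crossing_nested bX bY bZ bW or os mr ms.
have := min_crossing_nested bY bX bZ bW ori os mr' ms; rewrite nested_invl => c2.
have := min_crossing_nested bX bY bW bZ or osi mr ms'; rewrite nested_invr => c3.
have := min_crossing_nested bY bX bW bZ ori osi mr' ms'.
rewrite nested_invl nested_invr => c4.
have aligned t : separation t -> sep_order t < k -> min_crossing t X Y ->
    X \subset t.1 -> nested r t.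
  move=> ht ot mt Xt; apply: (min_crossing_nested bX bY bX bY or ot mr mt Xt).
  by case/andP: mr => /efficientP[_ ]; rewrite distinguishes_kblocks // => /andP[].
move: c1 c2 c3 c4; rewrite /= (side1 _ bW) (side1 _ bZ) (side2 _ bX) (side2 _ bY).
(* Of the sixteen positions, fourteen fall under one of [c1] to [c4]. In the two left over, [s]
   distinguishes [X] from [Y] and [r] distinguishes [Z] from [W], with opposite alignments. *)
case Xs: (X \subset s.2); case Ys: (Y \subset s.2);
case Zr: (Z \subset r.2); case Wr: (W \subset r.2) => //= c1 c2 c3 c4;
  do ?[exact: c1 | exact: c2 | exact: c3 | exact: c4].
- rewrite -nested_invr; apply: aligned; rewrite ?sep_inv_separation ?Xs //.
  apply: (min_crossing_both bX bY bW bZ) mr ms' _ _ => //.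
    by rewrite /distinguishes /= side2 // Xs Ys.
  by rewrite distinguishes_inv /distinguishes side1 // Zr Wr.
- apply: aligned => //; last by rewrite side2 // Xs.
  apply: (min_crossing_both bX bY bZ bW) mr ms _ _ => //.
    by rewrite /distinguishes side2 // Xs Ys.
  by rewrite distinguishes_inv /distinguishes side1 // Zr Wr.
Qed.

Lemma block_separators_distinguish X Y : kblock k X -> kblock k Y -> X != Y ->
  exists2 r, r \in block_separators & distinguishes r X Y.
Proof.
move=> bX bY nXY; have [s es os] := kblocks_efficient bX bY nXY.
have [r er mr] := @arg_minnP _ s (fun r => efficient r X Y) (@crossing_number G) es.
exists r; last by case/efficientP: er.
apply/block_separatorsP; exists X, Y; split=> //.
  by rewrite (efficient_order er es).
by rewrite /min_crossing er; apply/forall_inP.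
Qed.

Lemma block_separators_tight r : r \in block_separators ->
  [/\ tight_sep r, proper_sep r & sep_order r < k].
Proof.
case/block_separatorsP=> X [Y [_ _ or /andP[er _]]].
by rewrite (efficient_tight er) (efficient_proper er).
Qed.

End Blocks.

(** * Automorphisms *)

Section Automorphisms.
Variable G : sgraph.
Implicit Types (a : {perm G}) (r s t : setpair G) (X Y Z : {set G}).
Implicit Types S N P : {set setpair G}.

Definition act_sep a s : setpair G := (a @: s.1, a @: s.2).

Lemma mem_act a X x : (a x \in a @: X) = (x \in X).
Proof. by rewrite mem_imset //; apply: perm_inj. Qed.

Lemma act_subset a X Y : (a @: X \subset a @: Y) = (X \subset Y).
Proof.
apply/idP/idP; last exact: imsetS.
by move/subsetP=> h; apply/subsetP => x xX; rewrite -(mem_act a) h ?mem_act.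
Qed.

Lemma actK a X : a^-1%g @: (a @: X) = X.
Proof.
by rewrite -imset_comp -[RHS]imset_id; apply: eq_imset => x /=; rewrite permK.
Qed.

Lemma actKV a X : a @: (a^-1%g @: X) = X.
Proof. by rewrite -{1}(invgK a) actK. Qed.

Lemma actI a X Y : a @: (X :&: Y) = a @: X :&: a @: Y.
Proof. by apply: imsetI => x y _ _; apply: perm_inj. Qed.

Lemma act_sepK a s : act_sep a^-1%g (act_sep a s) = s.
Proof. by case: s => A B; rewrite /act_sep /= !actK. Qed.

Lemma act_sepKV a s : act_sep a (act_sep a^-1%g s) = s.
Proof. by rewrite -{1}(invgK a) act_sepK. Qed.

Lemma act_sep_inj a : injective (act_sep a).
Proof. exact: can_inj (act_sepK a). Qed.

Lemma act_sep_inv a s : act_sep a (sep_inv s) = sep_inv (act_sep a s).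
Proof. by []. Qed.

Lemma act_sep_le a r s : sep_le (act_sep a r) (act_sep a s) = sep_le r s.
Proof. by rewrite /sep_le !act_subset. Qed.

Lemma act_nested a r s : nested (act_sep a r) (act_sep a s) = nested r s.
Proof. by rewrite /nested -!act_sep_inv !act_sep_le. Qed.

Lemma act_order a s : sep_order (act_sep a s) = sep_order s.
Proof. by rewrite /sep_order -actI card_imset //; apply: perm_inj. Qed.

Lemma act_crossing_number a s : crossing_number (act_sep a s) = crossing_number s.
Proof.
rewrite -[RHS](card_imset _ (@act_sep_inj a)); apply: eq_card => t.
rewrite inE -(act_sepKV a t) mem_imset; last exact: act_sep_inj.
by rewrite inE /cross act_nested.
Qed.

Lemma automorphismV a : automorphism a -> automorphism a^-1%g.
Proof. by move=> ha x y; rewrite -ha !permKV. Qed.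

Lemma act_separation a s : automorphism a -> separation (act_sep a s) = separation s.
Proof.
(* One implication is enough: applied to the inverse automorphism it gives the other. *)
suff h (b : {perm G}) t : automorphism b -> separation t -> separation (act_sep b t).
  move=> ha; apply/idP/idP => [|]; last exact: h.
  by move=> /(h _ _ (automorphismV ha)); rewrite act_sepK.
move=> hb /separationP[e n]; apply/separationP; split=> [|x y] /=.
  apply/setP => x; rewrite -(permKV b x) in_setU !mem_act -in_setU e.
  by rewrite !inE.
by rewrite -(permKV b x) -(permKV b y) !mem_act hb; apply: n.
Qed.

Lemma act_distinguishes a s X Y :
  distinguishes (act_sep a s) (a @: X) (a @: Y) = distinguishes s X Y.
Proof. by rewrite /distinguishes !act_subset. Qed.

Lemma act_efficient a s X Y : automorphism a ->
  efficient (act_sep a s) (a @: X) (a @: Y) = efficient s X Y.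
Proof.
suff h (b : {perm G}) t (U W : {set G}) : automorphism b -> efficient t U W ->
    efficient (act_sep b t) (b @: U) (b @: W).
  move=> ha; apply/idP/idP => [|]; last exact: h.
  by move=> /(h _ _ _ _ (automorphismV ha)); rewrite act_sepK !actK.
move=> hb /efficientP[ht dt mt]; apply/efficientP; split.
- by rewrite act_separation.
- by rewrite act_distinguishes.
move=> r; rewrite -(act_sepKV b r) act_separation // act_distinguishes 2!act_order.
exact: mt.
Qed.

Lemma act_separates a Z x y : automorphism a ->
  separates (a @: Z) (a x) (a y) -> separates Z x y.
Proof.
move=> ha; rewrite /separates !mem_act => /and3P[-> ->] /=; apply: contra.
case/connectP=> p pp ->; apply/connectP; exists (map a p); last by rewrite last_map.
elim: p x pp => //= z p IH x /andP[xz pz].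
by rewrite IH // !mem_act ha xz.
Qed.

Lemma act_kblock a k X : automorphism a -> kblock k (a @: X) = kblock k X.
Proof.
have ins (b : {perm G}) (U : {set G}) : automorphism b -> inseparable k U -> inseparable k (b @: U).
  move=> hb /'forall_in_forall_inP h; apply/'forall_in_forall_inP.
  move=> x xU y yU; apply/forallP => Z.
  move: xU yU; rewrite -(permKV b x) -(permKV b y) !mem_act => xU yU.
  have /forallP /(_ (b^-1%g @: Z)) := h _ xU _ yU.
  rewrite card_imset; last exact: perm_inj.
  case: (#|Z| < k) => //=; apply: contra; rewrite -{1}(actKV b Z).
  exact: act_separates.
suff h (b : {perm G}) (U : {set G}) : automorphism b -> kblock k U -> kblock k (b @: U).
  move=> ha; apply/idP/idP => [|]; last exact: h.
  by move=> /(h _ _ (automorphismV ha)); rewrite actK.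
move=> hb /maxsetP[/andP[cU iU] mU]; apply/maxsetP; split.
  by rewrite card_imset ?cU ?ins //; apply: perm_inj.
move=> W /andP[cW iW] UW; rewrite -(actKV b W); suff -> : b^-1%g @: W = U by []; apply: mU.
  by rewrite card_imset ?cW ?ins //; [apply: automorphismV | apply: perm_inj].
by rewrite -(act_subset b) actKV.
Qed.

(** Order, efficiency and crossing number are invariant, hence so is the set of minimisers over all
    pairs of blocks. *)
Lemma act_block_separators a k s : automorphism a ->
  s \in block_separators G k -> act_sep a s \in block_separators G k.
Proof.
move=> ha /block_separatorsP[X [Y [bX bY os /andP[es /forall_inP ms]]]].
apply/block_separatorsP; exists (a @: X), (a @: Y); split.
- by rewrite act_kblock.
- by rewrite act_kblock.
- by rewrite act_order.
rewrite /min_crossing act_efficient // es; apply/forall_inP => r.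
rewrite -(act_sepKV a r) act_efficient // 2!act_crossing_number; exact: ms.
Qed.

Lemma act_block_profile a k X s : automorphism a ->
  (act_sep a s \in block_profile k (a @: X)) = (s \in block_profile k X).
Proof. by move=> ha; rewrite !inE act_separation // act_order act_subset. Qed.

Definition stabilizes a N := forall s, s \in N -> act_sep a s \in N.

Lemma acts_onV a S : acts_on_system a S -> acts_on_system a^-1%g S.
Proof.
rewrite /acts_on_system => {1}<-; rewrite -imset_comp -[RHS]imset_id.
by apply: eq_imset => s; exact: act_sepK.
Qed.

Lemma acts_on_stabilizes a S : acts_on_system a S -> stabilizes a S.
Proof. by move=> h s sS; rewrite -h; apply: imset_f. Qed.

End Automorphisms.

(** * The tree-decomposition of a nested system *)

Section NestedTree.
Variables (G : sgraph) (N : {set setpair G}).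
Hypothesis N_sym : symmetric_system N.
Hypothesis N_proper : forall s, s \in N -> proper_sep s.
Implicit Types (r s t : setpair G) (O : {set setpair G}) (X : {set G}).

(** * Consistent orientations of a nested system *)

Definition down_closed O :=
  [forall s in O, forall r in N, sep_le r s ==> (r \in O)].

(** Containing [s] means pointing towards [s.2]; closure downwards is the usual consistency
    condition. *)
Definition orientation O :=
  [&& O \subset N, [forall s in N, (s \in O) != (sep_inv s \in O)] & down_closed O].

Lemma down_closedP O :
  reflect (forall r s, r \in N -> s \in O -> sep_le r s -> r \in O) (down_closed O).
Proof.
apply: (iffP 'forall_in_forall_inP) => [h r s rN sO rs|h s sO r rN].
  by have := h s sO r rN; rewrite rs.
by apply/implyP; apply: h.
Qed.

Lemma orientationP O :
  reflect [/\ O \subset N, forall s, s \in N -> (sep_inv s \in O) = (s \notin O) &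
              forall r s, r \in N -> s \in O -> sep_le r s -> r \in O]
          (orientation O).
Proof.
apply: (iffP and3P) => [[ON /forall_inP f /down_closedP d]|[ON f d]]; split=> //.
- by move=> s /f; case: (s \in O); case: (sep_inv s \in O).
- by apply/forall_inP => s /f ->; case: (s \in O).
- exact/down_closedP.
Qed.

(** Both sides of [s] would lie in [t.1], which would then be the whole vertex set, so [t] would not
    be proper. *)
Lemma sep_le_inv_false s t : s \in N -> sep_le s t -> sep_le (sep_inv s) t ->
  t \notin N.
Proof.
move=> sN /andP[h1 h2] /andP[/= h3 h4]; apply/negP => tN.
have /and3P[hs _ _] := N_proper sN; have /and3P[_ _ /negP] := N_proper tN; apply.
have [e _] := separationP _ hs.
by apply: subset_trans (subsetT _) _; rewrite -e subUset h1 h3.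
Qed.

(* A maximal partial orientation is total: a minimal unoriented separation
   could be added to it. *)
Lemma orientation_extend O : O \subset N -> (forall s, s \in O -> sep_inv s \notin O) ->
  down_closed O -> exists2 O', orientation O' & O \subset O'.
Proof.
move=> ON cO dO.
pose p (Q : {set setpair G}) :=
  [&& Q \subset N, [forall s in Q, sep_inv s \notin Q] & down_closed Q].
have pO : p O by rewrite /p ON dO andbT; apply/forall_inP.
have [M /maxsetP[/and3P[MN /forall_inP cM /down_closedP dM] mM] OM] := maxset_exists pO.
exists M => //; apply/orientationP; split=> // s sN.
apply/idP/idP => [sM|sM]; first by have := cM _ sM; rewrite sep_invK.
apply: contraT => siM.
(* The unoriented separations are closed under inversion, so the inverse of a maximal one is
   minimal, and everything in [N] strictly below it is already oriented. *)
have [m [mU mmax] _] := @exists_sep_maximal _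
  [set t in N | (t \notin M) && (sep_inv t \notin M)] s
  ltac:(by rewrite inE sN sM siM).
move: mU; rewrite inE => /and3P[mN mM1 mM2].
suff e : sep_inv m |: M = M by rewrite -e setU11 in mM2.
apply: mM; rewrite ?subsetUr //; apply/and3P; split.
- by rewrite subUset sub1set N_sym.
- apply/forall_inP => t; rewrite !inE => /orP[/eqP->|tM].
    rewrite sep_invK negb_or mM1 andbT; apply/negP => /eqP e.
    have /and3P[_ /negP h _] := N_proper mN; apply: h.
    by rewrite [m in m.1]e.
  rewrite negb_or (cM _ tM) andbT; apply: contra mM1 => /eqP e.
  by rewrite -(sep_invK m) -e sep_invK.
apply/down_closedP => r t rN; rewrite !inE => /orP[/eqP->|tM] rt; last first.
  by rewrite (dM r t rN tM rt) orbT.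
have [//|/= ne] := eqVneq r (sep_inv m).
have mr : sep_le m (sep_inv r) by rewrite sep_le_invr.
apply: contraT => rM; case/negP: ne; apply/eqP.
rewrite -(mmax (sep_inv r)) ?sep_invK // inE N_sym //= sep_invK rM andbT.
by apply: contra mM1 => riM; apply: dM mN riM mr.
Qed.

Definition orientation_part O : {set G} := \bigcap_(s in O) s.2.

Lemma orientation_partP O X :
  reflect (forall s, s \in O -> X \subset s.2) (X \subset orientation_part O).
Proof. exact: (iffP bigcapsP). Qed.

Lemma orientation_containing X s :
  (forall r, r \in N -> (X \subset r.1) || (X \subset r.2)) ->
  s \in N -> X \subset s.2 ->
  exists O, [/\ orientation O, s \in O & X \subset orientation_part O].
Proof.
move=> hX sN Xs.
(* The choices forced by [X], together with everything below [s]. The latter matters when [X] lies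
   in both sides of [s], where [X] alone forces nothing. *)
pose O := [set r in N | ~~ (X \subset r.1) || sep_le r s].
have ON : O \subset N by apply/subsetP => r; rewrite inE => /andP[].
have X2 r : r \in O -> X \subset r.2.
  rewrite inE => /andP[rN /orP[n|/andP[_ h]]]; last exact: subset_trans Xs h.
  by have := hX r rN; rewrite (negPf n).
have cO r : r \in O -> sep_inv r \notin O.
  move=> rO; apply/negP => riO; have X1 : X \subset r.1 := X2 _ riO.
  move: (rO) (riO); rewrite !inE /= X1 (X2 _ rO) /= => /andP[rN rs] /andP[_ ris].
  by have := sep_le_inv_false rN rs ris; rewrite sN.
have dO : down_closed O.
  apply/down_closedP => r t rN; rewrite !inE => /andP[_ tO] rt; rewrite rN /=.
  case/orP: tO => h; last by rewrite (sep_le_trans rt h) orbT.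
  by apply/orP; left; apply: contra h => h; apply: subset_trans h _; case/andP: rt.
have [O' oO' OO'] := orientation_extend ON cO dO.
exists O'; split=> //; first by apply: (subsetP OO'); rewrite inE sN sep_le_refl orbT.
apply/orientation_partP => r rO'; have [ON' f _] := orientationP _ oO'.
have rN := subsetP ON' _ rO'; have := hX r rN.
apply: contraTT => n; rewrite (negPf n) orbF; apply/negP => X1.
have : sep_inv r \in O by rewrite inE N_sym //= n.
by move/(subsetP OO'); rewrite f // rO'.
Qed.

Lemma orientation_part_exists X :
  (forall r, r \in N -> (X \subset r.1) || (X \subset r.2)) ->
  exists2 O, orientation O & X \subset orientation_part O.
Proof.
move=> hX; have [e|/set0Pn[s sN]] := eqVneq N set0.
  exists set0; last by apply/orientation_partP => s; rewrite inE.
  by apply/orientationP; split=> [|s|r s]; rewrite ?sub0set ?e ?inE.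
case/orP: (hX s sN) => Xs.
  by have [O [? _ ?]] := orientation_containing hX (N_sym sN) Xs; exists O.
by have [O [? _ ?]] := orientation_containing hX sN Xs; exists O.
Qed.

(** * Stars: the two ends of a tree edge *)

Hypothesis N_nested : forall r s, r \in N -> s \in N -> nested r s.

(** For [s] in [N], the unique orientation with [s] as a maximal element: the end, on the side
    [s.2], of the tree edge given by [s]. Any other separation takes the orientation that points
    towards this edge. *)
Definition star s := [set r in N | sep_le r s || (sep_le r (sep_inv s) && (r != sep_inv s))].

Lemma star_refl s : s \in N -> s \in star s.
Proof. by move=> sN; rewrite inE sN sep_le_refl. Qed.

(** Nestedness places [r] or its inverse below [s] or [sep_inv s]; properness forbids that both are
    below the same one. What remains is Boolean. *)
Lemma star_orientation s : s \in N -> orientation (star s).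
Proof.
move=> sN; apply/orientationP; split=> [|r rN|r t rN].
- by apply/subsetP => r; rewrite inE => /andP[].
- have no t t' : t \in N -> t' \in N -> ~~ (sep_le t t' && sep_le (sep_inv t) t').
    move=> tN t'N; apply/negP => /andP[h1 h2].
    by have := sep_le_inv_false tN h1 h2; rewrite t'N.
  have := no _ _ rN sN; have := no _ _ rN (N_sym sN).
  have := no _ _ sN rN; have := no _ _ sN (N_sym rN).
  have := N_nested rN sN; rewrite /nested !inE rN N_sym //= !sep_le_inv.
  rewrite (inj_eq (can_inj (@sep_invK G))) (sep_le_invl r s) (sep_le_invr r s).
  have -> : (r == s) = sep_le r s && sep_le s r.
    by apply/eqP/andP => [->|[]]; [rewrite sep_le_refl | apply: sep_le_anti].
  have -> : (r == sep_inv s) = sep_le s (sep_inv r) && sep_le (sep_inv s) r.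
    apply/eqP/andP => [->|[h1 h2]]; first by rewrite sep_invK !sep_le_refl.
    by apply: sep_le_anti => //; rewrite sep_le_invr.
  by case: (sep_le r s); case: (sep_le s r); case: (sep_le s (sep_inv r));
     case: (sep_le (sep_inv s) r).
- rewrite !inE => /andP[tN /orP[ts|/andP[ts nt]]] rt; rewrite rN /=.
    by rewrite (sep_le_trans rt ts).
  rewrite (sep_le_trans rt ts) /=; apply/orP; right; apply: contra nt => /eqP e.
  by apply/eqP; apply: sep_le_anti => //; rewrite -e.
Qed.

(** Moving along a tree edge reverses only the separation of that edge. All later arguments about
    paths rest on this. *)
Lemma star_flip r s : r \in star s -> r \notin star (sep_inv s) -> r = s.
Proof.
rewrite !inE sep_invK => /andP[-> /=].
have [//|/= ne] := eqVneq r s; rewrite andbT.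
by case/orP=> [->|/andP[-> _]]; rewrite ?orbT.
Qed.

Lemma star_invN s : s \in N -> s \notin star (sep_inv s).
Proof.
move=> sN; have /orientationP[_ f _] := star_orientation (N_sym sN).
by rewrite -f // star_refl // N_sym.
Qed.

(** * The tree of orientations *)

Definition node := {O : {set setpair G} | orientation O}.
Implicit Types u v w : node.

Definition node_adj u v :=
  [exists s in N, (val u == star s) && (val v == star (sep_inv s))].

Lemma node_adjP u v :
  reflect (exists s, [/\ s \in N, val u = star s & val v = star (sep_inv s)])
          (node_adj u v).
Proof.
apply: (iffP exists_inP) => [[s sN /andP[/eqP e1 /eqP e2]]|[s [sN e1 e2]]].
  by exists s.
by exists s => //; rewrite e1 e2 !eqxx.
Qed.

Lemma node_adj_sym : symmetric node_adj.
Proof.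
suff h u v : node_adj u v -> node_adj v u by move=> u v; apply/idP/idP; apply: h.
case/node_adjP=> s [sN eu ev]; apply/node_adjP; exists (sep_inv s).
by rewrite N_sym ?sep_invK.
Qed.

Lemma node_adj_irrefl : irreflexive node_adj.
Proof.
move=> u; apply/node_adjP => -[s [sN e1 e2]].
by have := star_invN sN; rewrite -e2 e1 star_refl.
Qed.

Definition nested_tree := SGraph node_adj_sym node_adj_irrefl.

Lemma node_flip u v s : node_adj u v -> s \in val u -> s \notin val v ->
  val u = star s /\ val v = star (sep_inv s).
Proof.
case/node_adjP=> r [rN -> ->] h1 h2.
by rewrite (star_flip h1 h2).
Qed.

Lemma nodeN u s : s \in val u -> s \in N.
Proof. by have /orientationP[h _ _] := valP u; apply: (subsetP h). Qed.

Lemma node_inv u s : s \in N -> (sep_inv s \in val u) = (s \notin val u).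
Proof. by have /orientationP[_ h _] := valP u; apply: h. Qed.

Lemma node_down u r s : r \in N -> s \in val u -> sep_le r s -> r \in val u.
Proof. by have /orientationP[_ _ h] := valP u; apply: h. Qed.

Lemma node_sub_eq u v : val u \subset val v -> val u = val v.
Proof.
move=> uv; apply/eqP; rewrite eqEsubset uv; apply/subsetP => s sv.
apply: contraT => su; have sN := nodeN sv.
by move: su; rewrite -node_inv // => /(subsetP uv); rewrite node_inv // sv.
Qed.

Definition star_node s (sN : s \in N) : node := exist _ (star s) (star_orientation sN).

(** One inclusion suffices between orientations. If [r] in [star s] were missing from [u], then
    [sep_inv r] would be in [u] and above [s], hence equal to [s], which the star excludes. *)
Lemma maximal_star u s : sep_maximal (val u) s -> val u = star s.
Proof.
case=> su ms; have sN := nodeN su.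
have -> : star s = val (star_node sN) by [].
apply/esym/node_sub_eq/subsetP => r; rewrite inE => /andP[rN /orP[rs|/andP[rs nr]]].
  exact: node_down rN su rs.
apply: contraT; rewrite -node_inv // => ru.
by move: nr; rewrite -(ms _ ru) ?sep_invK ?eqxx // sep_le_invr.
Qed.

(** Induction on the number of separations of [u] missing from [v]: a maximal one among them is
    maximal in [u], so reversing it leads to a neighbour closer to [v]. Common elements are never
    reversed, so the walk keeps [O]. *)
Lemma node_connect (O : {set setpair G}) u v : O \subset val u -> O \subset val v ->
  connect [rel x y : node | [&& node_adj x y, O \subset val x & O \subset val y]] u v.
Proof.
have [n] := ubnP #|val u :\: val v|; elim: n u => // n IH u un Ou Ov.
have [e|/set0Pn[s0 s0D]] := eqVneq (val u :\: val v) set0.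
  have -> : u = v by apply/val_inj/node_sub_eq; rewrite -setD_eq0 e.
  exact: connect0.
have [s [sD ms] _] := exists_sep_maximal s0D.
move: (sD); rewrite inE => /andP[sv su]; have sN := nodeN su.
have eu : val u = star s.
  apply: maximal_star; split=> // r ru sr; apply: ms => //; rewrite inE ru andbT.
  by apply: contra sv => rv; apply: node_down sN rv sr.
pose w := star_node (N_sym sN).
have uw : node_adj u w by apply/node_adjP; exists s.
have Ow : O \subset val w.
  apply/subsetP => r rO; apply: contraT => rw.
  have e := star_flip (s := s) _ rw; rewrite -eu (subsetP Ou _ rO) in e.
  by move: sv; rewrite -(e isT) (subsetP Ov _ rO).
apply: (connect_trans (y := w)); first by apply: connect1; rewrite /= uw Ou Ow.
apply: IH => //; rewrite ltnS in un; apply: leq_trans un; apply: proper_card.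
apply/properP; split; last by exists s => //; rewrite inE (negPf (star_invN sN)) andbF.
apply/subsetP => r; rewrite !in_setD => /andP[rv rw]; rewrite rv /=.
apply: contraT => ru; rewrite node_adj_sym in uw.
have [e1 _] := node_flip uw rw ru.
have e : r = sep_inv s.
  by apply: (star_flip rw); rewrite sep_invK -eu.
by move: rv; rewrite e node_inv // negbK (negPf sv).
Qed.

(** The first node without [s] can only be entered through the edge of [s]. *)
Lemma path_flip u p s : path node_adj u p -> s \in val u -> s \notin val (last u p) ->
  exists p1 p2 x y, [/\ u :: p = p1 ++ x :: y :: p2, val x = star s &
                        val y = star (sep_inv s)].
Proof.
elim: p u => [|w p IH] u /=; first by move=> _ ->.
case/andP=> uw pw su sl; have [sw|sw] := boolP (s \in val w).
  by have [p1 [p2 [x [y [-> ex ey]]]]] := IH w pw sw sl; exists (u :: p1), p2, x, y.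
by exists [::], p, u, w; have [-> ->] := node_flip uw su sw.
Qed.

Lemma nested_tree_connect (u v : nested_tree) : connect adj u v.
Proof.
have := node_connect (sub0set (val u)) (sub0set (val v)).
by apply: connect_sub => x y /and3P[xy _ _]; apply: connect1.
Qed.

(* Going round a cycle, an edge [(star s, star (sep_inv s))] is crossed back,
   but only its two ends allow this. *)
Lemma nested_tree_acyclic (c : seq nested_tree) : 2 < size c -> ~~ ucycleb adj c.
Proof.
case: c => [|u [|v [|w c]]] // _; apply/negP; rewrite /ucycleb => /andP[cyc un].
move: cyc; rewrite [path.cycle _ _]/= => /andP[/node_adjP[s [sN eu ev]] pv].
have sv : sep_inv s \in val v by rewrite ev star_refl ?N_sym.
have su : sep_inv s \notin val u by rewrite node_inv // eu star_refl.
have := @path_flip v (rcons (w :: c) u) (sep_inv s) pv sv.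
rewrite last_rcons => /(_ su)[p1 [p2 [x [y [e ex ey]]]]].
have xv : x = v by apply: val_inj; rewrite ex ev.
have yu : y = u by apply: val_inj; rewrite ey eu sep_invK.
have un' : uniq (v :: rcons (w :: c) u).
  by rewrite -(rot_uniq 1) /rot /= ?drop0 ?take0 ?cats1 in un.
move: e un; rewrite {}xv {}yu; case: p1 => [|z p1] [].
  by move=> -> _ /=; rewrite !inE eqxx orbT.
by move=> _ e; move: un'; rewrite rcons_cons e /= mem_cat inE eqxx orbT.
Qed.

Lemma nested_tree_is_tree : is_tree nested_tree.
Proof.
split; [|exact: nested_tree_connect|exact: nested_tree_acyclic].
have [O oO _] : exists2 O, orientation O & set0 \subset orientation_part O.
  by apply: orientation_part_exists => r _; rewrite sub0set.
by apply/card_gt0P; exists (exist _ O oO).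
Qed.

(** * Parts and the axioms of a tree-decomposition *)

Definition node_part u := orientation_part (val u).

Lemma node_part_exists X :
  (forall r, r \in N -> (X \subset r.1) || (X \subset r.2)) ->
  exists u, X \subset node_part u.
Proof.
by move=> /orientation_part_exists[O oO XO]; exists (exist _ O oO).
Qed.

Lemma nested_cover_vertex x : exists u, x \in node_part u.
Proof.
have [r rN|u] := @node_part_exists [set x]; last by rewrite sub1set; exists u.
by rewrite !sub1set separation_cover //; case/and3P: (N_proper rN).
Qed.

Lemma nested_cover_edge x y : adj x y ->
  exists u, (x \in node_part u) && (y \in node_part u).
Proof.
move=> xy; have [r rN|u] := @node_part_exists [set x; y].
  have /and3P[hr _ _] := N_proper rN.
  have := separation_cover x hr; have := separation_cover y hr.
  have [_ n] := separationP _ hr; move: (n x y) (n y x); rewrite (adj_sym y) xy.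
  rewrite !subUset !sub1set.
  case: (x \in r.1); case: (x \in r.2); case: (y \in r.1); case: (y \in r.2) => //=;
  by do ?[move=> /(_ isT isT) // | move=> _].
by rewrite subUset !sub1set; exists u.
Qed.

(** If [v] contains some [s] that neither end contains, the path crosses the edge of [s] before [v]
    and back after it, visiting [star (sep_inv s)] twice. *)
Lemma nested_path u p v : path node_adj u p -> uniq (u :: p) -> v \in u :: p ->
  node_part u :&: node_part (last u p) \subset node_part v.
Proof.
move=> pu un vp; apply/subsetP => x; rewrite inE -!sub1set => /andP[xu xl].
apply/orientation_partP => s sv; have sN := nodeN sv.
have [su|su] := boolP (s \in val u); first by move/orientation_partP: xu; apply.
have [sl|sl] := boolP (s \in val (last u p)); first by move/orientation_partP: xl; apply.
have uv : u != v by apply: contraNneq su => ->.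
case/splitPl: vp pu un sl => p1 p2 lv; rewrite cat_path last_cat lv.
case/andP=> pu1 pu2 un sl.
have [q1 [q2 [x1 [y1 [e1 ex1 ey1]]]]] : exists p3 p4 x y,
    [/\ u :: p1 = p3 ++ x :: y :: p4, val x = star (sep_inv s) &
        val y = star (sep_inv (sep_inv s))].
  by apply: path_flip => //; rewrite ?node_inv ?N_sym // lv negbK.
have [q3 [q4 [x2 [y2 [e2 ex2 ey2]]]]] := path_flip pu2 sv sl.
have e : x1 = y2 by apply: val_inj; rewrite ex1 ey2.
move: un; rewrite -cat_cons cat_uniq => /and3P[_ /hasPn h _].
have : y2 \in p2.
  case: q3 e2 => [[_ ->]|z q3 [_ ->]]; first by rewrite inE eqxx.
  by rewrite mem_cat !inE eqxx !orbT.
by move/h; rewrite e1 -e mem_cat inE eqxx orbT.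
Qed.

Definition nested_decomposition : tree_decomposition G :=
  @TreeDecomposition G nested_tree node_part nested_tree_is_tree
    nested_cover_vertex nested_cover_edge nested_path.

(** The nodes on the side of [u] contain [s], since only the deleted edge reverses [s]. Conversely a
    vertex of [s.2] lies in the part of some node containing [s], and such nodes are joined to [u]
    without dropping [s]. *)
Lemma nested_side (u v : nested_tree) s : s \in N -> val u = star s ->
  val v = star (sep_inv s) -> td_side (D := nested_decomposition) u v = s.2.
Proof.
move=> sN eu ev; have su : s \in val u by rewrite eu star_refl.
apply/eqP; rewrite eqEsubset; apply/andP; split.
  apply/bigcupsP => w; rewrite (_ : td_part w = orientation_part (val w)) //.
  case/connectP=> p pu lw; suff sw : s \in val w by apply: bigcap_inf.
  elim/last_ind: p w pu lw => [|p w' IH] w; first by move=> _ ->.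
  rewrite rcons_path last_rcons => /andP[pu /= /andP[lw' ne]] ww'.
  have sl := IH _ pu erefl; rewrite ww'; apply: contraNT ne => sw'.
  have [e1 e2] := node_flip lw' sl sw'.
  have -> : last u p = u by apply: val_inj; rewrite e1 eu.
  have -> // : w' = v by apply: val_inj; rewrite e2 ev.
apply/subsetP => x xs.
have [r rN||O [oO sO xO]] := @orientation_containing [set x] s _ sN.
- by rewrite !sub1set separation_cover //; case/and3P: (N_proper rN).
- by rewrite sub1set.
apply/bigcupP; exists (exist _ O oO : nested_tree); last by rewrite sub1set in xO.
have := @node_connect [set s] u (exist _ O oO).
rewrite !sub1set => /(_ su sO); apply: connect_sub => y z /and3P[yz].
rewrite !sub1set => sy sz; apply: connect1; rewrite /= yz /=.
apply/eqP => e; have : v \in [set y; z] by rewrite e !inE eqxx orbT.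
by rewrite !inE => /orP[]/eqP ev'; move: sy sz; rewrite -ev' ev (negPf (star_invN sN)).
Qed.

Lemma nested_induced : induced_seps nested_decomposition = N.
Proof.
apply/setP => s; apply/imsetP/idP => [[[u v]]|sN].
  rewrite inE => /node_adjP[r [rN eu ev]] ->.
  have rN' := N_sym rN; have := nested_side rN eu ev.
  have := nested_side (u := v) (v := u) rN' ev.
  by rewrite sep_invK => /(_ eu) /= -> ->; apply: rN'.
(* The order is reversed because [star s] lies on the side [s.2]. *)
exists (star_node (N_sym sN) : nested_tree, star_node sN : nested_tree).
  by rewrite inE; apply/node_adjP; exists (sep_inv s); rewrite N_sym // sep_invK.
have -> := @nested_side (star_node (N_sym sN)) (star_node sN) (sep_inv s).
- have -> := @nested_side (star_node sN) (star_node (N_sym sN)) s sN erefl erefl.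
  by case: (s).
- exact: N_sym.
- by [].
- by rewrite sep_invK.
Qed.

(** * Symmetries of the tree *)

Lemma act_orientation (a : {perm G}) O : stabilizes a N -> stabilizes a^-1%g N ->
  orientation O -> orientation (act_sep a @: O).
Proof.
move=> aN aN' /orientationP[ON f d].
have ai := @act_sep_inj G a.
apply/orientationP; split=> [|s|r s].
- by apply/subsetP => _ /imsetP[s sO ->]; apply/aN/(subsetP ON).
- rewrite -(act_sepKV a s) -act_sep_inv !mem_imset // => /aN'.
  by rewrite act_sepK => /f.
rewrite -(act_sepKV a s) -(act_sepKV a r) !mem_imset // act_sep_le => /aN'.
by rewrite act_sepK; apply: d.
Qed.

Lemma act_star (a : {perm G}) s : stabilizes a N -> stabilizes a^-1%g N ->
  star (act_sep a s) = act_sep a @: star s.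
Proof.
move=> aN aN'; have ai := @act_sep_inj G a; apply/setP => r.
rewrite -(act_sepKV a r) mem_imset // !inE -act_sep_inv !act_sep_le (inj_eq ai).
by congr (_ && _); apply/idP/idP => [/aN'|/aN]; rewrite ?act_sepK.
Qed.

Lemma act_orientation_part (a : {perm G}) O :
  a @: orientation_part O = orientation_part (act_sep a @: O).
Proof.
apply/setP => x; rewrite -(permKV a x) mem_act.
apply/bigcapP/bigcapP => h s.
  by case/imsetP=> t tO ->; rewrite mem_act; apply: h.
by move=> sO; have := h _ (imset_f (act_sep a) sO); rewrite mem_act.
Qed.

Lemma nested_canonical (a : {perm G}) : stabilizes a N -> stabilizes a^-1%g N ->
  exists2 f : {perm nested_tree}, automorphism f &
    forall u : nested_tree, a @: node_part u = node_part (f u).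
Proof.
move=> aN aN'; have ai := @act_sep_inj G a.
pose g (u : node) : node := exist (fun O => orientation O) _ (act_orientation aN aN' (valP u)).
have gi : injective g.
  by move=> u v [] /(imset_inj ai) ?; apply: val_inj.
exists (perm gi : {perm nested_tree}); last first.
  by move=> u; rewrite permE; apply: act_orientation_part.
move=> u v; rewrite !permE; apply/node_adjP/node_adjP => -[s [sN eu ev]].
  exists (act_sep a^-1%g s); split; first exact: (aN' _ sN).
    apply: (imset_inj ai); rewrite -act_star // act_sepKV; exact: eu.
  apply: (imset_inj ai); rewrite -act_star // act_sep_inv act_sepKV; exact: ev.
by exists (act_sep a s); rewrite aN // -act_sep_inv !act_star // -eu -ev.
Qed.

End NestedTree.

(** * Separations induced by a tree-decomposition *)

Section TreeEdges.
Variable T : sgraph.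
Hypothesis T_tree : is_tree T.
Implicit Types t u v w : T.

Definition minus_edge t u := [rel a b : T | adj a b && ([set a; b] != [set t; u])].

Lemma minus_edgeC t u : connect (minus_edge t u) =2 connect (minus_edge u t).
Proof. by apply: eq_connect => a b; rewrite /= [in [set u; t]]setUC. Qed.

Lemma minus_edge_sym t u : connect_sym (minus_edge t u).
Proof. by apply: sym_connect_sym => a b; rewrite /= adj_sym setUC. Qed.

Lemma minus_edge_or t u v :
  connect (minus_edge t u) t v || connect (minus_edge t u) u v.
Proof.
have [_ /(_ t v)/connectP[p pt ->] _] := T_tree.
elim/last_ind: p pt => [|p w IH]; first by rewrite connect0.
rewrite rcons_path last_rcons => /andP[/IH {}IH lw]; set l := last t p in IH lw.
have [e|ne] := eqVneq [set l; w] [set t; u].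
  have : w \in [set t; u] by rewrite -e !inE eqxx orbT.
  by rewrite !inE => /orP[]/eqP ->; rewrite connect0 ?orbT.
have lw' : connect (minus_edge t u) l w by apply: connect1; rewrite /= lw ne.
by case/orP: IH => h; rewrite (connect_trans h lw') ?orbT.
Qed.

(** A path avoiding the edge would close up with it to a cycle. It has at least three nodes, since a
    shorter one would be a loop or the deleted edge itself. *)
Lemma minus_edge_disconnected t u : adj t u -> ~~ connect (minus_edge t u) t u.
Proof.
move=> tu; apply/negP => /connectP[p0 p0P ul].
case/shortenP: p0P ul => p pP up _ ul {p0}.
have pT : path adj t p by apply: sub_path pP => a b /andP[].
have [_ _ /(_ (t :: p))] := T_tree; rewrite /ucycleb up andbT.
have -> : path.cycle adj (t :: p).
  by rewrite /path.cycle rcons_path pT -ul adj_sym tu.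
case: p pP ul {up pT} => [|x [|y p]] /=; last by move=> _ _ /(_ isT).
  by move=> _ e; move: tu; rewrite e adj_irrefl.
by move=> /andP[/andP[_ /negP h] _] e; case: h; rewrite e.
Qed.

Lemma minus_edge_notboth t u v : adj t u ->
  connect (minus_edge t u) t v -> ~~ connect (minus_edge t u) u v.
Proof.
move=> tu tv; apply: contra (minus_edge_disconnected tu) => uv.
by apply: connect_trans tv _; rewrite minus_edge_sym.
Qed.

(** The edge [t'u'] lies in the component of [t], so a walk staying in the component of [u] never
    uses it. *)
Lemma minus_edge_nested t u t' u' : adj t' u' ->
  connect (minus_edge t u) t t' -> connect (minus_edge t u) t u' ->
  connect (minus_edge t' u') t' u -> adj t u ->
  forall v, connect (minus_edge t u) u v -> connect (minus_edge t' u') t' v.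
Proof.
move=> t'u' tt' tu' t'u tu v /connectP[p]; elim/last_ind: p v => [|p w IH] v.
  by move=> _ ->.
rewrite rcons_path last_rcons => /andP[pu lw] ->.
apply: connect_trans (IH _ pu erefl) (connect1 _).
have ul : connect (minus_edge t u) u (last u p) by apply/connectP; exists p.
have /andP[lw' _] := lw; rewrite /= lw' /=; apply: contraL ul => /eqP e.
apply: minus_edge_notboth => //.
have : last u p \in [set t'; u'] by rewrite -e !inE eqxx.
by rewrite !inE => /orP[]/eqP->.
Qed.

Lemma minus_edge_map (h : {perm T}) t u v w : automorphism h ->
  connect (minus_edge t u) v w -> connect (minus_edge (h t) (h u)) (h v) (h w).
Proof.
move=> hh /connectP[p pv ->]; apply/connectP; exists (map h p); last by rewrite last_map.
elim: p v pv => //= x p IH v /andP[/andP[vx ne] px]; rewrite IH // andbT hh vx /=.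
apply: contra ne => /eqP e; apply/eqP/(imset_inj (@perm_inj _ h)).
by rewrite !imsetU1 !imset_set1.
Qed.

End TreeEdges.

(** * From tree edges to nested separations *)

Section InducedSeparations.
Variables (G : sgraph) (D : tree_decomposition G).
Implicit Types (t u v w : td_tree D) (X Y : {set G}).

Let tree := td_is_tree D.

Lemma td_side_sup t u v : connect (minus_edge t u) t v -> td_part v \subset td_side t u.
Proof. by move=> h; apply: (bigcup_sup v). Qed.

Lemma td_part_side t u v : (td_part v \subset td_side t u) || (td_part v \subset td_side u t).
Proof.
case/orP: (minus_edge_or tree t u v) => h; first by rewrite td_side_sup.
by rewrite (@td_side_sup u t) ?orbT // minus_edgeC.
Qed.

Lemma td_side_sub t u t' u' :
  (forall v, connect (minus_edge t u) t v -> connect (minus_edge t' u') t' v) ->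
  td_side t u \subset td_side t' u'.
Proof. by move=> h; apply/bigcupsP => v tv; apply: td_side_sup; apply: h. Qed.

Lemma induced_sepsP (s : setpair G) :
  reflect (exists t u, adj t u /\ s = (td_side t u, td_side u t)) (s \in induced_seps D).
Proof.
apply: (iffP imsetP) => [[[t u] tu ->]|[t [u [tu ->]]]].
  by rewrite inE in tu; exists t, u.
by exists (t, u); rewrite ?inE.
Qed.

Lemma induced_seps_sym : symmetric_system (induced_seps D).
Proof.
move=> s /induced_sepsP[t [u [tu ->]]]; apply/induced_sepsP.
by exists u, t; rewrite adj_sym.
Qed.

Lemma part_induced_side v s : s \in induced_seps D ->
  (td_part v \subset s.1) || (td_part v \subset s.2).
Proof. by case/induced_sepsP=> t [u [tu ->]]; apply: td_part_side. Qed.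

(** The component beyond [u] lies in that of [t'], and the one beyond [u'] in that of [t]. All other
    positions of two distinct edges reduce to this by reversing edges. *)
Lemma induced_nested_aux t u t' u' : adj t u -> adj t' u' ->
  connect (minus_edge t u) t t' -> connect (minus_edge t u) t u' ->
  connect (minus_edge t' u') t' t -> connect (minus_edge t' u') t' u ->
  nested (td_side t u, td_side u t) (td_side t' u', td_side u' t').
Proof.
move=> tu t'u' tt' tu' t't t'u.
rewrite -nested_invl; apply: sep_le_nested; rewrite /sep_le /=.
apply/andP; split; apply: td_side_sub => v; rewrite minus_edgeC.
  exact: (minus_edge_nested tree t'u' tt' tu' t'u tu).
exact: (minus_edge_nested tree tu t't t'u tu' t'u').
Qed.

Lemma induced_seps_nested r s :
  r \in induced_seps D -> s \in induced_seps D -> nested r s.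
Proof.
move=> /induced_sepsP[t [u [tu ->]]] /induced_sepsP[t' [u' [tu' ->]]].
have [e|ne] := eqVneq [set t; u] [set t'; u'].
  have : t \in [set t'; u'] by rewrite -e !inE eqxx.
  have : u \in [set t'; u'] by rewrite -e !inE eqxx orbT.
  rewrite !inE => /orP[]/eqP eu /orP[]/eqP et; move: tu; rewrite eu et ?adj_irrefl //.
    by move=> _; rewrite -nested_invl nested_refl.
  by move=> _; rewrite nested_refl.
have sw (x y z w : td_tree D) : adj x y -> [set x; y] != [set z; w] ->
  connect (minus_edge z w) z x -> connect (minus_edge z w) z y.
  by move=> xy n zx; apply: connect_trans zx (connect1 _); rewrite /= xy.
have sw' (x y z w : td_tree D) : adj x y -> [set x; y] != [set z; w] ->
  connect (minus_edge z w) w x -> connect (minus_edge z w) w y.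
  by move=> xy n zx; apply: connect_trans zx (connect1 _); rewrite /= xy.
have ut : adj u t by rewrite adj_sym. have ut' : adj u' t' by rewrite adj_sym.
have ne' : [set t'; u'] != [set t; u] by rewrite eq_sym.
case/orP: (minus_edge_or tree t u t') => h1; case/orP: (minus_edge_or tree t' u' t) => h2.
- exact: (induced_nested_aux tu tu' h1 (sw _ _ _ _ tu' ne' h1) h2 (sw _ _ _ _ tu ne h2)).
- have h1' := sw _ _ _ _ tu' ne' h1; have h2' := sw' _ _ _ _ tu ne h2.
  rewrite -nested_invr; apply: (induced_nested_aux tu ut' h1' h1);
  by rewrite minus_edgeC.
- have h1' := sw' _ _ _ _ tu' ne' h1; have h2' := sw _ _ _ _ tu ne h2.
  rewrite -nested_invl; apply: (induced_nested_aux ut tu' _ _ h2' h2);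
  by rewrite minus_edgeC.
have h1' := sw' _ _ _ _ tu' ne' h1; have h2' := sw' _ _ _ _ tu ne h2.
rewrite -nested_invl -nested_invr.
by apply: (induced_nested_aux ut ut'); rewrite minus_edgeC.
Qed.

(** The first edge of a path from [t] to [u] serves: the rest of the path avoids [t], hence that
    edge. *)
Lemma induced_between t u : t != u -> exists2 s, s \in induced_seps D &
  (td_part t \subset s.1) && (td_part u \subset s.2).
Proof.
move=> tu; have [_ /(_ t u)/connectP[p0 p0P ul0] _] := tree.
case/shortenP: p0P ul0 => -[|w p] /= pP; first by move=> _ _ e; rewrite e eqxx in tu.
case/andP: pP => tw pw /andP[tp _] _ ul.
exists (td_side t w, td_side w t); first by apply/induced_sepsP; exists t, w.
rewrite /= !td_side_sup ?connect0 // ul; apply/connectP; exists p => //.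
move: tp; rewrite inE negb_or => /andP[_ tp] {ul}.
have nwt : w != t by apply: contraTneq tw => ->; rewrite adj_irrefl.
suff gen y : y != t -> path adj y p -> path (minus_edge w t) y p by exact: gen.
elim: p y tp {pw} => // x p IH y + yt /= /andP[yx px].
rewrite inE negb_or => /andP[tx tp]; have xt : x != t by rewrite eq_sym.
rewrite yx (IH x tp xt px) andbT /=; apply/negP => /eqP e.
have : t \in [set y; x] by rewrite e !inE eqxx orbT.
by rewrite !inE eq_sym (negPf yt) (negPf tx).
Qed.

Lemma leaf_part t u : leaf t -> adj t u -> td_part t = td_side t u.
Proof.
rewrite /leaf => /cards1P[x ex] tu.
have xu : x = u by apply/eqP; rewrite eq_sym -in_set1 -ex inE.
apply/eqP; rewrite eqEsubset td_side_sup ?connect0 //=.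
apply/bigcupsP => v /connectP[[|w p] /=]; first by move=> _ ->.
case/andP=> /andP[tw ne] _ _; case/negP: ne; apply/eqP.
have : w \in [set u] by rewrite -xu -ex inE.
by rewrite inE => /eqP ->.
Qed.

Lemma canonical_stabilizes S (a : {perm G}) : canonical_td S D ->
  automorphism a -> acts_on_system a S -> stabilizes a (induced_seps D).
Proof.
move=> cD ha aS; have [f hf fD] := cD a ha aS.
(* Stated for an arbitrary pair of maps so that it also applies to the inverses, which turns the
   inclusion into equality. *)
have sub (b : {perm G}) (h : {perm td_tree D}) t u : automorphism h ->
    (forall v, b @: td_part v = td_part (h v)) ->
    b @: td_side t u \subset td_side (h t) (h u).
  move=> hh hD; apply/subsetP => _ /imsetP[x /bigcupP[v tv xv] ->].
  apply: (subsetP (td_side_sup (minus_edge_map hh tv))).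
  by rewrite -hD mem_act.
have fD' v : a^-1%g @: td_part v = td_part (f^-1%g v).
  by rewrite -{1}(permKV f v) -fD actK.
have side t u : a @: td_side t u = td_side (f t) (f u).
  apply/eqP; rewrite eqEsubset sub //= -(act_subset a^-1%g) actK.
  by rewrite -{2}(permK f t) -{2}(permK f u) sub //; apply: automorphismV.
move=> s /induced_sepsP[t [u [tu ->]]]; apply/induced_sepsP.
by exists (f t), (f u); rewrite hf /act_sep /= !side.
Qed.

End InducedSeparations.

(** * Isolating well separated blocks *)

Section Isolation.
Variables (k : nat) (G : sgraph) (S : {set setpair G}).
Hypothesis S_sym : symmetric_system S.
Hypothesis S_proper : forall s, s \in S -> proper_sep s /\ sep_order s < k.
Hypothesis S_tight :
  forall s, tight_sep s -> proper_sep s -> sep_order s < k -> s \in S.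
Implicit Types (r s t m q : setpair G) (X Y Z : {set G}) (N P : {set setpair G}).

(** * Maximal elements of block profiles *)

Definition sep_maximalb P s := (s \in P) && [forall r in P, sep_le s r ==> (r == s)].

Lemma sep_maximalP P s : reflect (sep_maximal P s) (sep_maximalb P s).
Proof.
apply: (iffP andP) => [[sP /forall_inP h]|[sP h]]; split=> //.
  by move=> r rP sr; apply/eqP; have := h r rP; rewrite sr.
by apply/forall_inP => r rP; apply/implyP => sr; apply/eqP/h.
Qed.

Definition well_separatedb X :=
  [forall r, forall s, sep_maximalb (block_profile k X :&: S) r ==>
     sep_maximalb (block_profile k X :&: S) s ==> nested r s].

Lemma well_separatedP X : reflect (well_separated k S X) (well_separatedb X).
Proof.
apply: (iffP idP) => [h r s mr ms|h].
  move/forallP/(_ r)/forallP/(_ s): h.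
  by move/sep_maximalP: mr => ->; move/sep_maximalP: ms => ->.
apply/forallP => r; apply/forallP => s; apply/implyP => /sep_maximalP mr.
by apply/implyP => /sep_maximalP ms; apply: h.
Qed.

Lemma profileE X s : s \in S -> (s \in block_profile k X :&: S) = (X \subset s.2).
Proof.
move=> sS; have [/and3P[hs _ _] os] := S_proper sS.
by rewrite !inE hs os sS andbT.
Qed.

Lemma S_side X s : kblock k X -> s \in S -> (X \subset s.1) = ~~ (X \subset s.2).
Proof.
move=> bX sS; have [/and3P[hs _ _] os] := S_proper sS; exact: kblock_sideN bX hs os.
Qed.

(* Every [s] in [S] lies, up to inversion, below a maximal element of the
   profile, and the latter is nested with [m]. *)
Lemma maximal_nested X m s : kblock k X -> well_separated k S X ->
  sep_maximal (block_profile k X :&: S) m -> s \in S -> nested s m.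
Proof.
move=> bX wX mm; have mS : m \in S by case: mm; rewrite inE => /andP[].
have Xm : X \subset m.2 by case: mm => /[swap] _; rewrite profileE.
suff h t : t \in S -> X \subset t.2 -> nested t m.
  move=> sS; have := S_side bX sS; case Xs: (X \subset s.2) => Xs'; first exact: h.
  by rewrite -nested_invl; apply: h; [apply: S_sym | exact: Xs'].
move=> tS Xt; have tP : t \in block_profile k X :&: S by rewrite profileE.
have [n mn tn] := exists_sep_maximal tP.
have nS : n \in S by case: mn; rewrite inE => /andP[].
have Xn : X \subset n.2 by case: mn => /[swap] _; rewrite profileE.
have := wX n m mn mm; case/or4P=> h.
- exact/sep_le_nested/(sep_le_trans tn).
- by have := mm.2 n mn.1 h => e; rewrite -e; apply: sep_le_nested.
- by rewrite -nested_invr; apply/sep_le_nested/(sep_le_trans tn).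
(* Here [sep_inv m] is below [n], so [X] would lie in both sides of [n]. *)
have := S_side bX nS; rewrite Xn /=.
case/andP: h => h _; by rewrite (subset_trans Xm).
Qed.

(** An efficient separation of [v] from [X] is tight, hence in [S]. A maximal element above it has
    an even smaller second side, which still avoids [v]. *)
Lemma kblock_avoiding X v : kblock k X -> v \notin X ->
  exists2 m, sep_maximal (block_profile k X :&: S) m & v \notin m.2.
Proof.
move=> bX vX; have [s es os] := kblock_efficient_vertex bX vX.
have sS := S_tight (efficient_tight es) (efficient_proper es) os.
have [_ /andP[vs Xs] _] := efficientP _ _ _ es; rewrite sub1set in vs.
have Xs2 : X \subset s.2 by move: Xs; rewrite S_side // negbK.
have sP : s \in block_profile k X :&: S by rewrite profileE.
have [m mm /andP[_ sm]] := exists_sep_maximal sP.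
by exists m => //; apply: contra vs => /(subsetP sm).
Qed.

Definition isolators : {set setpair G} :=
  [set s | [exists X, [&& kblock k X, well_separatedb X &
                       sep_maximalb (block_profile k X :&: S) s]]].

Lemma isolatorsP s :
  reflect (exists X, [/\ kblock k X, well_separated k S X &
                         sep_maximal (block_profile k X :&: S) s])
          (s \in isolators).
Proof.
rewrite inE; apply: (iffP existsP) => -[X h]; exists X.
  by case/and3P: h => ? /well_separatedP ? /sep_maximalP.
by case: h => ? /well_separatedP ? /sep_maximalP ?; apply/and3P.
Qed.

Lemma isolators_sub s : s \in isolators -> s \in S.
Proof. by case/isolatorsP=> X [_ _ []]; rewrite inE => /andP[]. Qed.

Lemma isolators_nested r s : r \in isolators -> s \in S -> nested s r.
Proof. by case/isolatorsP=> X [bX wX mr]; apply: maximal_nested bX wX mr. Qed.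

Lemma act_sep_maximal (a : {perm G}) X s : automorphism a -> acts_on_system a S ->
  sep_maximal (block_profile k X :&: S) s ->
  sep_maximal (block_profile k (a @: X) :&: S) (act_sep a s).
Proof.
move=> ha aS; have aS' := acts_onV aS.
have mem (t : setpair G) : (act_sep a t \in block_profile k (a @: X) :&: S) =
                           (t \in block_profile k X :&: S).
  rewrite ![_ \in _ :&: _]inE act_block_profile //; congr (_ && _).
  apply/idP/idP; last exact: acts_on_stabilizes.
  by move/(acts_on_stabilizes aS'); rewrite act_sepK.
case=> sP ms; split=> [|r]; first by rewrite mem.
by rewrite -(act_sepKV a r) mem act_sep_le => rP sr; rewrite (ms _ rP sr).
Qed.

Lemma act_well_separated (a : {perm G}) X : automorphism a -> acts_on_system a S ->
  well_separated k S X -> well_separated k S (a @: X).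
Proof.
move=> ha aS wX r s mr ms; rewrite -(act_nested a^-1%g).
have ha' := automorphismV ha; have aS' := acts_onV aS.
have := act_sep_maximal ha' aS' mr; have := act_sep_maximal ha' aS' ms.
by rewrite actK => ms' mr'; apply: wX.
Qed.

Lemma isolators_stable (a : {perm G}) : automorphism a -> acts_on_system a S ->
  stabilizes a isolators.
Proof.
move=> ha aS s /isolatorsP[X [bX wX ms]]; apply/isolatorsP; exists (a @: X).
by split; [rewrite act_kblock | apply: act_well_separated | apply: act_sep_maximal].
Qed.

Lemma isolates (D : tree_decomposition G) :
  isolators \subset induced_seps D -> isolates_well_separated_blocks S k D.
Proof.
move=> iD X t bX wX Xt; apply/eqP; rewrite eqEsubset Xt andbT.
apply/subsetP => v vt; apply: contraT => vX.
have [m mm vm] := kblock_avoiding bX vX.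
have mI : m \in isolators by apply/isolatorsP; exists X.
case/orP: (part_induced_side t (subsetP iD _ mI)) => h.
  have Xm : X \subset m.2 by case: mm; rewrite inE => /andP[]; rewrite inE => /and3P[].
  by have := S_side bX (isolators_sub mI); rewrite (subset_trans Xt h) Xm.
by rewrite (subsetP h) in vm.
Qed.

Lemma block_profilesP P :
  reflect (exists2 X, kblock k X & P = block_profile k X) (P \in block_profiles G k).
Proof.
apply: (iffP imsetP) => -[X bX ->]; exists X => //; first by rewrite inE in bX.
by rewrite inE.
Qed.

(* If [X] is the only block in the leaf part and [s] its induced separation,
   feasibility makes every maximal element of the profile of [X] lie above [s];
   two of them that cross would then have a common upper bound. *)
Lemma leaf_blocks (D : tree_decomposition G) : induced_seps D \subset S ->
  separates_blocks k D -> isolates_well_separated_blocks S k D ->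
  reduced S (block_profiles G k) -> feasible S (block_profiles G k) ->
  leaf_parts_are_blocks k D.
Proof.
move=> DS [_ sepD] isoD red feas t lt.
have [u tu] : exists u, adj t u.
  by case/cards1P: (lt) => u e; exists u; have := set11 u; rewrite -e inE.
have sI : (td_side u t, td_side t u) \in induced_seps D.
  by apply/induced_sepsP; exists u, t; rewrite adj_sym.
move: (subsetP DS _ sI) (leaf_part lt tu); set s := (_, _) => sS ts.
have mem P X (r : setpair G) : P = block_profile k X -> r \in P -> X \subset r.2.
  by move=> ->; rewrite inE => /and3P[].
(* Reducedness, applied to [s], puts a block [X] into the leaf part and a block [Y] on the opposite
   side. *)
have [P [P' [/block_profilesP[X bX eX] /block_profilesP[Y bY eY] sP sP']]] := red s sS.
have Xs : X \subset s.2 := mem _ _ _ eX sP; have Ys : Y \subset s.1 := mem _ _ _ eY sP'.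
have others Z : kblock k Z -> Z <> X -> Z \subset s.1.
  move=> bZ ZX; rewrite S_side //; apply/negP => Zs.
  by apply: (sepD _ _ _ _ bZ bX ZX _ _ (erefl (td_part t))); rewrite ts.
have inP Z r : r \in S -> Z \subset r.2 -> r \in block_profile k Z.
  by move=> rS; rewrite -(profileE Z rS) inE => /andP[].
have join r r' Z : r \in S -> r' \in S -> X \subset r.2 -> X \subset r'.2 ->
    kblock k Z -> Z \subset r.1 -> Z \subset r'.1 -> cross r r' ->
    exists q, [/\ q \in block_profile k X :&: S, sep_le r q & sep_le r' q].
  move=> rS rS' Xr Xr' bZ Zr Zr' rr'.
  have [||||||q qP /andP[/= h1 h2]] :=
      feas r r' rS rS' rr' (block_profile k X) (block_profile k Z).
  - by apply/block_profilesP; exists X.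
  - by apply/block_profilesP; exists Z.
  - exact: inP.
  - exact: inP.
  - by apply: inP; [apply: S_sym | exact: Zr].
  - by apply: inP; [apply: S_sym | exact: Zr'].
  exists q; split=> //; rewrite /sep_le.
    by rewrite (subset_trans (subsetUl _ _) h1) (subset_trans h2 (subsetIl _ _)).
  by rewrite (subset_trans (subsetUr _ _) h1) (subset_trans h2 (subsetIr _ _)).
have maxP r : sep_maximal (block_profile k X :&: S) r ->
    [/\ r \in S, X \subset r.2 & forall q, q \in block_profile k X :&: S -> sep_le r q -> q = r].
  case=> rP mr; have rS : r \in S by move: rP; rewrite inE => /andP[].
  by split; rewrite -?(profileE X rS).
have above r : sep_maximal (block_profile k X :&: S) r -> sep_le s r.
  case/maxP=> rS Xr mr.
  have [P1 [P2 [_ /block_profilesP[Z bZ eZ] _ rP2]]] := red r rS.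
  have Zr : Z \subset r.1 := mem _ _ _ eZ rP2.
  have ZX : Z <> X by move=> e; move: Zr; rewrite e S_side // Xr.
  have Zs := others Z bZ ZX.
  (* Both [r] and [s] have [Z] in the first side and [X] in the second. If they cross, feasibility
     gives an upper bound, which maximality identifies with [r]. *)
  have [|rs] := boolP (nested r s); last first.
    have [q [qP rq sq]] := join r s Z rS sS Xr Xs bZ Zr Zs rs.
    by rewrite -(mr q qP rq).
  case/or4P=> // [rs|/andP[rs _]|/andP[sr _]].
  - by rewrite (mr s _ rs) ?sep_le_refl // profileE.
  - by move: (S_side bZ sS); rewrite Zs (subset_trans Zr rs).
  - by move: (S_side bX rS); rewrite Xr (subset_trans Xs sr).
suff wX : well_separated k S X by rewrite (isoD X t bX wX) // ts.
move=> r r' mr mr'; apply: contraT => rr'.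
have [rS Xr mxr] := maxP r mr; have [rS' Xr' mxr'] := maxP r' mr'.
have /andP[sr _] := above r mr; have /andP[sr' _] := above r' mr'.
(* [Y] lies in [s.1], hence in the first side of every maximal element, so it can be the second
   block in feasibility. *)
have [q [qP rq rq']] := join r r' Y rS rS' Xr Xr' bY
  (subset_trans Ys sr) (subset_trans Ys sr') rr'.
by move: rr'; rewrite -(mxr q qP rq) (mxr' q qP rq') nested_refl.
Qed.

(** The common core of both claims: [N] is the set of block separators for existence, and the set
    induced by the given decomposition for refinement. *)
Lemma nested_extension N : N \subset S -> symmetric_system N ->
  (forall r s, r \in N -> s \in N -> nested r s) ->
  (forall a : {perm G}, automorphism a -> acts_on_system a S -> stabilizes a N) ->
  (forall X Y, kblock k X -> kblock k Y -> X <> Y ->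
     exists2 s, s \in N & (X \subset s.1) && (Y \subset s.2)) ->
  exists D : tree_decomposition G,
    N \subset induced_seps D /\
    [/\ canonical_td S D, induced_seps D \subset S, separates_blocks k D,
        isolates_well_separated_blocks S k D
      & reduced S (block_profiles G k) -> feasible S (block_profiles G k) ->
        leaf_parts_are_blocks k D].
Proof.
move=> NS N_sym N_nest N_can N_dist.
pose M := N :|: (isolators :|: [set s | sep_inv s \in isolators]).
have inM s : (s \in M) = [|| s \in N, s \in isolators | sep_inv s \in isolators].
  by rewrite in_setU in_setU in_set.
have MS s : s \in M -> s \in S.
  rewrite inM => /or3P[/(subsetP NS)//|/isolators_sub//|].
  by move/isolators_sub/S_sym; rewrite sep_invK.
have M_sym : symmetric_system M.
  move=> s; rewrite !inM sep_invK => /or3P[/N_sym ->//|->|->]; by rewrite !orbT.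
have M_proper s : s \in M -> proper_sep s by move/MS/S_proper => [].
have isoM r s : r \in isolators -> s \in M -> nested s r.
  by move=> ri /MS; apply: isolators_nested.
have M_nested r s : r \in M -> s \in M -> nested r s.
  move=> rM sM; move: (rM) (sM); rewrite !inM.
  case/or3P=> hr; [|by rewrite nestedC isoM|by rewrite -nested_invl nestedC isoM].
  case/or3P=> hs; [exact: N_nest|exact: isoM|by rewrite -nested_invr isoM].
have M_can (a : {perm G}) : automorphism a -> acts_on_system a S -> stabilizes a M.
  move=> ha aS s; rewrite !inM -act_sep_inv.
  case/or3P=> h; first by rewrite (N_can a ha aS).
    by rewrite (isolators_stable ha aS h) orbT.
  by rewrite (isolators_stable ha aS h) !orbT.
pose D := nested_decomposition M_sym M_proper M_nested.
have DM : induced_seps D = M by apply: nested_induced.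
have DS : induced_seps D \subset S by rewrite DM; apply/subsetP.
have sepD : separates_blocks k D.
  split=> [X bX|X Y t u bX bY XY Xt Yu tu].
    apply: node_part_exists => // r rM.
    by have [/and3P[hr _ _] or] := S_proper (MS _ rM); apply: kblock_side bX hr or.
  have [s sN /andP[Xs Ys]] := N_dist X Y bX bY XY.
  have sM : s \in M by rewrite inM sN.
  have sI : s \in induced_seps D by rewrite DM.
  have sS := MS s sM; case/orP: (part_induced_side t sI) => h.
    by move: (S_side bY sS); rewrite Ys (subset_trans Yu) // -tu.
  by move: (S_side bX sS); rewrite Xs (subset_trans Xt).
have isoD : isolates_well_separated_blocks S k D.
  by apply: isolates; rewrite DM; apply/subsetP => s si; rewrite inM si orbT.
exists D; split; first by rewrite DM subsetUl.
split=> //; last exact: leaf_blocks.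
move=> a ha aS; apply: nested_canonical; first exact: M_can.
by apply: M_can; [apply: automorphismV | apply: acts_onV].
Qed.

End Isolation.

Theorem theorem3p1 (k : nat) (G : sgraph) (S : {set setpair G})
    (k_ge1 : 1 <= k)
    (S_sym : symmetric_system S)
    (S_proper : forall s, s \in S -> proper_sep s /\ sep_order s < k)
    (S_tight : forall s, tight_sep s -> proper_sep s -> sep_order s < k -> s \in S) :
  (exists D : tree_decomposition G,
     [/\ canonical_td S D,
         induced_seps D \subset S,
         separates_blocks k D,
         isolates_well_separated_blocks S k D
       & reduced S (block_profiles G k) -> feasible S (block_profiles G k) ->
         leaf_parts_are_blocks k D])
  /\
  (forall D : tree_decomposition G,
     canonical_td S D -> induced_seps D \subset S -> separates_blocks k D ->
     exists D' : tree_decomposition G,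
       refines D' D /\
       [/\ canonical_td S D',
           induced_seps D' \subset S,
           separates_blocks k D',
           isolates_well_separated_blocks S k D'
         & reduced S (block_profiles G k) -> feasible S (block_profiles G k) ->
           leaf_parts_are_blocks k D']).
Proof.
split.
  have sub : block_separators G k \subset S.
    by apply/subsetP => s /block_separators_tight[]; apply: S_tight.
  have [|||X Y bX bY /eqP XY|D [_ HD]] := nested_extension S_sym S_proper S_tight sub.
  - exact: block_separators_inv.
  - exact: block_separators_nested.
  - by move=> a ha _ s; apply: act_block_separators.
  - have [s sN ds] := block_separators_distinguish bX bY XY.
    have [_ /and3P[hs _ _] os] := block_separators_tight sN.
    by exists s; rewrite -?(distinguishes_kblocks bX bY hs os).
  by exists D.
move=> D cD DS [blocksD sepD]; apply: nested_extension => //.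
- exact: induced_seps_sym.
- exact: induced_seps_nested.
- by move=> a ha aS; apply: canonical_stabilizes cD ha aS.
move=> X Y bX bY XY; have [t Xt] := blocksD X bX; have [u Yu] := blocksD Y bY.
(* The first condition on the given decomposition separates distinct blocks by an edge of its tree,
   as the extension requires. *)
have tu : t != u.
  by apply/eqP => e; apply: (sepD X Y t u) => //; rewrite e.
have [s sI /andP[ts us]] := induced_between tu.
by exists s => //; rewrite (subset_trans Xt ts) (subset_trans Yu us).
Qed.
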